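(* Fix $\varepsilon>0$ and let the online two-point direct search described in the context be run with the constant probing ratio $$\delta_t\equiv\delta=\frac{4\varepsilon}{3\sqrt{2\pi p}\,L}.$$ Let $T\ge2$ be an even integer, let $\mathcal{E}_T=\frac{2D_T+2B_T}{T}$, and suppose that $$\mathcal{E}_T\le\frac{\varepsilon^2}{9\pi p L}.$$ Then, if $T$ satisfies $$T\ge 9\pi p L\,\big(\Phi_0(u_0)-\Phi_{\mathrm{low}}\big)\,\varepsilon^{-2},$$ the iterates satisfy $$\min_{t\in[T]_2}\mathbb{E}\big[\|\nabla\Phi_t(u_t)\|\big]\le\varepsilon .$$
   Context: $\mathbb{N}=\{0,1,2,\dots\}$, $p\ge1$ is an integer, and $\|\cdot\|$ is the Euclidean norm. For even $T\ge2$, $[T]_2=\{0,2,\dots,T-2\}$. Objectives: for each $t\in\mathbb{N}$, $\Phi_t:\mathbb{R}^p\to\mathbb{R}$ is differentiable with $L$-Lipschitz continuous gradient (same constant $L>0$ for all $t$), and $\Phi_t(u)\ge\Phi_{\mathrm{low}}$ for all $u$ and $t$, with $\Phi_{\mathrm{low}}\in\mathbb{R}$. Inexact oracle: for each $t$, $\tilde\Phi_t:\mathbb{R}^p\to\mathbb{R}$ is a (deterministic) continuous function. Temporal drift: $d_t=\sup_{u\in\mathbb{R}^p}|\Phi_{t+1}(u)-\Phi_t(u)|$, assumed finite for all $t$, and $D_T=\sum_{t=0}^{T-1}d_t$. Oracle error: $b_t=\sup_{u\in\mathbb{R}^p}|\tilde\Phi_t(u)-\Phi_t(u)|$, assumed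 finite for all $t$, and $B_T=\sum_{t=0}^{T-1}b_t$. Online two-point direct search: given a deterministic $u_0\in\mathbb{R}^p$ and a deterministic sequence of positive probing ratios $\delta_t$, for $t=0,2,4,\dots$: draw $v_t\sim\mathcal{N}(0,\frac1pI_p)$ independently of all previous draws, set $u_{t+1}=u_t+\delta_tv_t$, and set $u_{t+2}=u_{t+1}$ if $\tilde\Phi_{t+1}(u_{t+1})\le\tilde\Phi_t(u_t)$, and $u_{t+2}=u_t$ otherwise. $\mathbb{E}$ is expectation over the random directions. *)

(* Defs.v *)
From mathcomp Require Import all_boot all_order all_algebra.
From mathcomp Require Import all_classical all_reals all_analysis.
Set Implicit Arguments.
Unset Strict Implicit.
Unset Printing Implicit Defensive.
Import Order.TTheory GRing.Theory Num.Theory.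
Import numFieldNormedType.Exports.
Local Open Scope classical_set_scope.
Local Open Scope ring_scope.

(* The norm `|u| that the library puts on 'rV[R]_p is the sup norm; it induces
   the right topology (hence differentiability, continuity and Borel sets), but
   the Euclidean norm has to be defined separately. *)
Definition enorm (R : realType) (p : nat) (u : 'rV[R]_p) : R :=
  Num.sqrt (\sum_(i < p) u 0 i ^+ 2).

Definition gradient (R : realType) (p : nat) (f : 'rV[R]_p -> R)
    (u : 'rV[R]_p) : 'rV[R]_p :=
  \row_(i < p) ('d f u (delta_mx 0 i)).

Definition smooth (R : realType) (p : nat) (L : R) (f : 'rV[R]_p -> R) : Prop :=
  (forall u, differentiable f u) /\
  (forall u w, enorm (gradient f u - gradient f w) <= L * enorm (u - w)).

Definition gaps (R : realType) (p : nat) (f g : 'rV[R]_p -> R) : set R :=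
  [set `|f u - g u| | u in [set: 'rV[R]_p]].

(* [sup] is 0 by convention on unbounded sets, so finiteness of the suprema
   below must be assumed separately, as [has_ubound (gaps _ _)]. *)
Definition drift (R : realType) (p : nat) (Phi : nat -> 'rV[R]_p -> R)
    (t : nat) : R := sup (gaps (Phi t.+1) (Phi t)).

Definition oracle_error (R : realType) (p : nat)
    (Phi Phit : nat -> 'rV[R]_p -> R) (t : nat) : R :=
  sup (gaps (Phit t) (Phi t)).

Definition total_drift (R : realType) (p : nat) (Phi : nat -> 'rV[R]_p -> R)
    (T : nat) : R := \sum_(0 <= t < T) drift Phi t.

Definition total_oracle_error (R : realType) (p : nat)
    (Phi Phit : nat -> 'rV[R]_p -> R) (T : nat) : R :=
  \sum_(0 <= t < T) oracle_error Phi Phit t.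

Definition borel_rV (R : realType) (p : nat) :=
  g_sigma_algebraType (@open 'rV[R]_p).

(* Lebesgue integral over R^n, as an iterated integral; it is only used for
   nonnegative Borel integrands, where Tonelli's theorem applies. *)
Fixpoint integral_rV (R : realType) (n : nat) :
    ('rV[R]_n -> \bar R) -> \bar R :=
  match n with
  | 0 => fun f => f 0
  | m.+1 => fun f =>
      (\int[@lebesgue_measure R]_x
         integral_rV (fun y : 'rV[R]_m => f (row_mx (x%:M : 'rV[R]_1) y)))%E
  end.

(* Density of N(m, S), for S symmetric positive definite. *)
Definition gaussian_pdf (R : realType) (p : nat) (m : 'rV[R]_p) (S : 'M[R]_p)
    (x : 'rV[R]_p) : R :=
  (Num.sqrt ((2 * pi) ^+ p * \det S))^-1 *
  expR (- (((x - m) *m invmx S *m (x - m)^T) 0 0 / 2)).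

Definition gaussian_vector (R : realType) (p : nat) (d : measure_display)
    (Omega : measurableType d) (P : probability Omega R)
    (m : 'rV[R]_p) (S : 'M[R]_p) (X : {RV P >-> borel_rV R p}) : Prop :=
  forall A : set (borel_rV R p), measurable A ->
    distribution P X A =
      integral_rV (fun x : 'rV[R]_p => (gaussian_pdf m S x * \1_A x)%:E).

(* Mutual independence of the subfamily of [X] indexed by [D]. *)
Definition mutually_independent (R : realType) (d d' : measure_display)
    (Omega : measurableType d) (E : measurableType d') (P : probability Omega R)
    (D : pred nat) (X : nat -> {RV P >-> E}) : Prop :=
  forall (s : seq nat) (A : nat -> set E),
    uniq s -> all D s -> (forall t, measurable (A t)) ->
    P [set w | forall t, t \in s -> A t (X t w)] =
      (\prod_(t <- s) P (X t @^-1` A t))%E.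

(* Only the values of [delta] and [v] at even times are used. *)
Definition two_point_direct_search (R : realType) (p : nat) (Omega : Type)
    (Phit : nat -> 'rV[R]_p -> R) (u0 : 'rV[R]_p) (delta : nat -> R)
    (v u : nat -> Omega -> 'rV[R]_p) : Prop :=
  (forall w, u 0%N w = u0) /\
  (forall t w, ~~ odd t ->
     u t.+1 w = u t w + delta t *: v t w /\
     u t.+2 w = if Phit t.+1 (u t.+1 w) <= Phit t (u t w)
                then u t.+1 w else u t w).

(* Main.v *)
From HB Require Import structures.
Require Import Defs.
From mathcomp Require Import all_boot all_order all_algebra.
From mathcomp Require Import all_classical all_reals all_analysis.
From mathcomp Require Import measurable_realfun.
From mathcomp Require Import ring lra.
Import Order.TTheory GRing.Theory Num.Theory.
Import numFieldNormedType.Exports.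
Local Open Scope classical_set_scope.
Local Open Scope ring_scope.

(** Let [t] be even, [x = u t w], [g] the gradient of [Phi t] at [x], [y = v t w],
    [de] the probing ratio and [c = L * de ^+ 2 / 2].  The accept/reject rule
    leaves the iterate no worse than both [x] and [x + de *: y], up to the drift
    and oracle errors of times [t] and [t.+1] ([search_step_decrease]).  By the
    descent inequality for Lipschitz gradients ([smooth_descent]), the objective
    therefore decreases, up to that error, by at least
    [gain de c g y = max 0 (- de * <g, y> - c * |y|^2)].  Since the objectives are
    bounded below, telescoping along the even times bounds the sum of the gains,
    surely and not only in mean ([sum_gain_le]).

    The gain is bounded below in mean by means of the symmetry of the Gaussian
    law: [gain y + gain (- y) >= de * |<g, y>| - c * |y|^2], so that the expected
    gain is at least half of [de * E|<g, y>| - c * E|y|^2] ([integral_gain_ge]).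
    The quadratic loss is thus halved as well, and the constants of the theorem
    rest on this: the cruder bound [max 0 (a - b) >= max 0 a - b] would charge the
    whole of [c] and give [4/3 * eps] instead of [eps].  Here
    [E|y|^2 <= 1], and [<g, y>] is a centred normal variable of standard deviation
    [|g| / sqrt p], hence [E|<g, y>| = 2 * |g| / sqrt (2 * pi * p)].

    Normality of [<g, y>] is the classical stability of normal laws under sums
    ([normal_convolution], by completing the square), applied one coordinate at
    a time to the Gaussian vector, whose law is first identified with an iterated
    product of normal laws ([gaussian_vector_distribution]).  In these bounds [g]
    is a constant vector; it may be replaced by the gradient at the random iterate
    because the iterate at time [t] is a function of the directions drawn before
    [t], hence independent of [v t] ([process_joint_integral]).

    Summing over the [T / 2] even times and inserting the value of [de], the
    assumed bounds on the initial gap and on the errors show that the mean over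
    the even times of [E|g|] does not exceed [eps]; so neither does its minimum. *)

Set Implicit Arguments.
Unset Strict Implicit.
Unset Printing Implicit Defensive.

(** * Borel measurability on row vectors *)

Lemma continuous_borel_measurable (R : realType) p (f : 'rV[R]_p -> R) :
  continuous f -> measurable_fun setT (f : borel_rV R p -> R).
Proof.
move=> /continuousP cf; apply: (measurability _ (measurable_realfun.RGenOpens.measurableE R)).
move=> _ [_ [a [b ->] <-]]; rewrite setTI.
by apply: sub_sigma_algebra; exact/cf/interval_open.
Qed.

Lemma measurable_coord (R : realType) p (i : 'I_p) :
  measurable_fun setT (fun x : borel_rV R p => (x : 'rV[R]_p) 0 i).
Proof. by apply: continuous_borel_measurable; exact: coord_continuous. Qed.

(** Second countability in the form used for measurability: the boxes with rational
    centre and radius [1 / n.+1] are countably many and, unlike general open sets,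
    are finite intersections of conditions on single coordinates. *)
Lemma open_rational_cover (R : realType) p (U : set 'rV[R]_p) :
  let B (qn : 'rV[rat]_p * nat) :=
    [set x : 'rV[R]_p | forall i, `|x 0 i - ratr (qn.1 0 i)| < qn.2.+1%:R^-1] in
  open U -> U = \bigcup_(qn in [set qn | B qn `<=` U]) B qn.
Proof.
move=> B oU; apply/seteqP; split=> [x Ux|x [qn /= BU]]; last exact: BU.
have /nbhs_ballP[e /= e0 eU] : nbhs x U by exact: open_nbhs_nbhs.
have [n ne] : exists n : nat, n.+1%:R^-1 < e / 2.
  have e20 : 0 < e / 2 by rewrite divr_gt0.
  have [n _ Hn] := near_infty_natSinv_lt (PosNum e20).
  by exists n; exact: (Hn n (leqnn n)).
have /choice[q qx] : forall i : 'I_p, exists q : rat,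
    `|x 0 i - ratr q| < n.+1%:R^-1.
  move=> i.
  have := @rat_in_itvoo R (x 0 i - n.+1%:R^-1) (x 0 i + n.+1%:R^-1).
  case; first by rewrite ltrD2l gtrN // invr_gt0.
  move=> q; rewrite in_itv /= => /andP[q1 q2]; exists q.
  by rewrite distrC ltr_distl q1 q2.
exists (\row_i q i, n) => /=; last by move=> i; rewrite mxE.
move=> y /= By; apply: eU; split=> // i j; rewrite (ord1 i).
rewrite /ball /= (splitr e) -(subrKA (ratr (q j))) .
apply: le_lt_trans (ler_normD _ _) _; apply: ltrD.
  by apply: lt_trans (qx j) ne.
by rewrite distrC; have := By j; rewrite mxE => H; exact: lt_trans H ne.
Qed.

(** The Borel sets of a product are generated by the coordinates, because every open
    set is a countable union of boxes. *)
Lemma measurable_fun_rV (R : realType) p d (T : measurableType d)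
  (f : T -> borel_rV R p) :
  (forall i, measurable_fun setT (fun x => (f x : 'rV[R]_p) 0 i)) ->
  measurable_fun setT f.
Proof.
move=> mf; apply: (@measurability _ _ T (borel_rV R p) setT f (@open 'rV[R]_p)) => //.
move=> _ [U /= oU <-]; rewrite setTI (open_rational_cover oU) preimage_bigcup.
rewrite bigcup_mkcond; apply: countable_bigcupT_measurable => // qn.
case: ifPn => // _.
rewrite [X in measurable X](_ : _ = \bigcap_(i in [set: 'I_p])
   (f @^-1` [set x : borel_rV R p | `|(x : 'rV[R]_p) 0 i - ratr (qn.1 0 i)| < qn.2.+1%:R^-1])); last first.
  by apply/seteqP; split=> x /= H i; [move=> _|]; exact: H.
apply: fin_bigcap_measurable => // i _.
have mB : measurable (ball (ratr (qn.1 0 i) : R) qn.2.+1%:R^-1).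
  by apply: measurable_realfun.open_measurable; exact: ball_open.
have := mf i measurableT _ mB; rewrite setTI; congr measurable.
by apply/seteqP; split=> x; rewrite /ball /= distrC.
Qed.

Lemma measurable_opp_rV (R : realType) n :
  measurable_fun setT (fun y : borel_rV R n => (- (y : 'rV[R]_n) : borel_rV R n)).
Proof.
apply: measurable_fun_rV => i.
under [X in measurable_fun _ X]eq_fun do rewrite mxE.
by apply: measurableT_comp => //; exact: measurable_coord.
Qed.

(** The splitting of coordinates along which [integral_rV] recurses. *)
Definition cons_rV (R : realType) n (xy : measurableTypeR R * borel_rV R n) : borel_rV R n.+1 :=
  row_mx ((xy.1 : R)%:M : 'rV[R]_1) (xy.2 : 'rV[R]_n).

Lemma cons_rV_coord0 (R : realType) n (x : R) (y : 'rV[R]_n) :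
  (cons_rV (x, y) : 'rV[R]_n.+1) 0 ord0 = x.
Proof.
have -> : (ord0 : 'I_n.+1) = lshift n (ord0 : 'I_1) by apply/val_inj.
by rewrite /cons_rV (@row_mxEl _ 1 1 n) mxE eqxx mulr1n.
Qed.

Lemma cons_rV_coordS (R : realType) n (x : R) (y : 'rV[R]_n) i :
  (cons_rV (x, y) : 'rV[R]_n.+1) 0 (lift ord0 i) = y 0 i.
Proof.
have -> : lift ord0 i = rshift 1 i by apply/val_inj.
by rewrite /cons_rV (@row_mxEr _ 1 1 n).
Qed.

Lemma measurable_cons_rV (R : realType) n : measurable_fun setT (@cons_rV R n).
Proof.
apply: measurable_fun_rV => i; rewrite /cons_rV.
case: (@split_ordP 1 n i) => j ->.
  under [X in measurable_fun _ X]eq_fun do rewrite (@row_mxEl _ 1 1 n) ord1 mxE eqxx mulr1n.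
  exact: measurable_fst.
under [X in measurable_fun _ X]eq_fun do rewrite (@row_mxEr _ 1 1 n).
exact: (measurableT_comp (measurable_coord j)).
Qed.

HB.instance Definition _ (R : realType) n :=
  isMeasurableFun.Build _ _ _ _ (@cons_rV R n) (@measurable_cons_rV R n).

(** * Euclidean geometry and the descent inequality *)

Definition dotp (R : realType) n (u v : 'rV[R]_n) : R :=
  \sum_(i < n) u 0 i * v 0 i.

Lemma enorm_sqr (R : realType) n (u : 'rV[R]_n) :
  enorm u ^+ 2 = \sum_(i < n) u 0 i ^+ 2.
Proof. by rewrite sqr_sqrtr // sumr_ge0 // => i _; exact: sqr_ge0. Qed.

Lemma enormZ (R : realType) n (t : R) (u : 'rV[R]_n) :
  enorm (t *: u) = `|t| * enorm u.
Proof.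
rewrite -sqrtr_sqr -sqrtrM ?sqr_ge0 // mulr_sumr; congr Num.sqrt.
by apply: eq_bigr => i _; rewrite mxE exprMn.
Qed.

Lemma dotpBl (R : realType) n (a b w : 'rV[R]_n) :
  dotp (a - b) w = dotp a w - dotp b w.
Proof. by rewrite /dotp -sumrB; apply: eq_bigr => i _; rewrite !mxE mulrBl. Qed.

Lemma dotpZr (R : realType) n (t : R) (a w : 'rV[R]_n) :
  dotp a (t *: w) = t * dotp a w.
Proof. by rewrite /dotp mulr_sumr; apply: eq_bigr => i _; rewrite !mxE mulrCA. Qed.

Lemma coord_le_enorm (R : realType) n (u : 'rV[R]_n) i : `|u 0 i| <= enorm u.
Proof.
rewrite -sqrtr_sqr ler_wsqrtr // (bigD1 i) //= lerDl.
by apply: sumr_ge0 => j _; exact: sqr_ge0.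
Qed.

Lemma diff_dotp_gradient (R : realType) n (f : 'rV[R]_n -> R) (u w : 'rV[R]_n) :
  'd f u w = dotp (gradient f u) w.
Proof.
rewrite {1}(row_sum_delta w) linear_sum /dotp; apply: eq_bigr => i _.
by rewrite linearZ mxE mulrC.
Qed.

(** A weighted Young inequality; the best weight [k] is known where it is applied, so
    it loses nothing against the Cauchy-Schwarz inequality. *)
Lemma dotp_young (R : realType) n (k : R) (u w : 'rV[R]_n) : 0 < k ->
  dotp u w <= (k^-1 * enorm u ^+ 2 + k * enorm w ^+ 2) / 2.
Proof.
move=> k0; rewrite !enorm_sqr !mulr_sumr -big_split /= mulr_suml.
apply: ler_sum => i _; rewrite -subr_ge0.
have -> : (k^-1 * u 0 i ^+ 2 + k * w 0 i ^+ 2) / 2 - u 0 i * w 0 i =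
   (u 0 i - k * w 0 i) ^+ 2 * (k^-1 / 2) by field; rewrite gt_eqF.
by rewrite mulr_ge0 ?sqr_ge0 // divr_ge0 // invr_ge0 ltW.
Qed.

(** Along a line, the difference quotient of [f] in direction [w] is literally that of
    the one-variable restriction, so no chain rule is involved. *)
Lemma is_derive_line (R : realType) n (f : 'rV[R]_n -> R) (u w : 'rV[R]_n) (t : R) :
  differentiable f (u + t *: w) ->
  is_derive t (1 : R) (fun t : R => f (u + t *: w))
    (dotp (gradient f (u + t *: w)) w).
Proof.
move=> df; rewrite -diff_dotp_gradient -deriveE //.
have E : (fun h : R => h^-1 *: (((fun t : R => f (u + t *: w)) \o shift t) (h *: 1) - f (u + t *: w))) =
   (fun h : R => h^-1 *: ((f \o shift (u + t *: w)) (h *: w) - f (u + t *: w))).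
  apply/funext => h; congr (_ *: (_ - _)) => /=; congr f.
  by rewrite scalerDl [h%:A]mulr1 addrCA.
split; last by rewrite /derive E.
by rewrite /derivable E; exact: diff_derivable.
Qed.

(** The difference of the two sides, restricted to the segment from [u] to [u + w],
    vanishes at [u] and has a nonpositive derivative, because the gradient at
    [u + t *: w] differs from that at [u] by at most [L * t * enorm w].  The mean
    value theorem concludes. *)
Lemma smooth_descent (R : realType) n (L : R) (f : 'rV[R]_n -> R) (u w : 'rV[R]_n) :
  0 < L -> smooth L f ->
  f (u + w) <= f u + dotp (gradient f u) w + L / 2 * enorm w ^+ 2.
Proof.
move=> L0 [df lip].
pose b := dotp (gradient f u) w; pose q := L / 2 * enorm w ^+ 2.
pose phi (t : R) := f (u + t *: w) - (t * b + t ^+ 2 * q).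
pose dphi (t : R) := dotp (gradient f (u + t *: w)) w - (b + 2 * t * q).
have dphiP t : is_derive t (1 : R) phi (dphi t).
  have H1 := is_derive_line (df (u + t *: w)).
  have H2 : is_derive t (1:R) (fun t : R => t * b + t ^+ 2 * q) (b + 2 * t * q).
    have Hid := @is_derive_id _ R t 1.
    have HX := @is_deriveX _ _ (@id R) 2 t 1 1 Hid.
    have HD := is_deriveD (is_deriveZ b Hid) (is_deriveZ q HX).
    have -> : (fun t : R => t * b + t ^+ 2 * q) = (b \*: id + q \*: (id ^+ 2))%R.
      by apply/funext => x; rewrite /= [x * b]mulrC [_ * q]mulrC.
    by apply: is_derive_eq HD _; rewrite /GRing.scale /=; ring.
  exact: is_deriveB.
have cphi : {within `[0, 1], continuous phi}.
  apply: continuous_subspaceT => x.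
  have /derivable1_diffP := @ex_derive _ _ _ _ _ _ _ (dphiP x).
  exact: differentiable_continuous.
have [c] := MVT ltr01 (fun x _ => dphiP x) cphi.
rewrite in_itv /= => /andP[c0 c1].
rewrite /phi !scale1r scale0r addr0 subr0 mulr1 mul0r expr0n mul0r addr0 subr0 mul1r expr1n mul1r => E.
have dphi_le : dphi c <= 0.
  rewrite /dphi.
  have -> : dotp (gradient f (u + c *: w)) w - (b + 2 * c * q) =
     dotp (gradient f (u + c *: w) - gradient f u) w - 2 * c * q.
    by rewrite opprD addrA dotpBl.
  (* The weight [L * c] balances the two terms of the Young inequality. *)
  have cL0 : 0 < L * c by rewrite mulr_gt0.
  rewrite subr_le0; apply: le_trans (dotp_young _ _ cL0) _.
  have uw : u + c *: w - u = c *: w by rewrite addrAC subrr add0r.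
  have := lip (u + c *: w) u; rewrite uw enormZ (gtr0_norm c0) mulrA.
  set D := enorm _; set W := enorm w => DW.
  have : D ^+ 2 <= (L * c * W) ^+ 2.
    by rewrite ler_pXn2r // nnegrE ?sqrtr_ge0 // mulr_ge0 ?sqrtr_ge0 // ltW.
  rewrite -(ler_pM2l (_ : 0 < (L * c)^-1)) ?invr_gt0 // => DW2.
  rewrite /q -/W ler_pdivrMr //.
  apply: le_trans (lerD DW2 (lexx _)) _.
  rewrite le_eqVlt; apply/orP; left; apply/eqP; field.
  by rewrite !gt_eqF.
rewrite -/b -/q; move: E dphi_le; set p := f (u + w) - _ => E ?; rewrite -subr_le0.
suff -> : f (u + w) - (f u + b + q) = dphi c by [].
by rewrite -E /p; ring.
Qed.

Lemma enorm_continuous (R : realType) n : continuous (@enorm R n).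
Proof.
move=> u; apply: (@cvg_comp _ _ _ (fun u : 'rV[R]_n => \sum_(i < n) u 0 i ^+ 2)
  Num.sqrt (nbhs u)); last exact: sqrt_continuous.
apply: (@cvg_big _ _ +%R 0 xpredT (@add_continuous R) _ (nbhs u)) => i _.
apply: (cvg_comp _ (fun x : R => x ^+ 2)); last exact: sqr_continuous.
exact: coord_continuous.
Qed.

Lemma gradient_coord_continuous (R : realType) n (L : R) (f : 'rV[R]_n -> R) i :
  smooth L f -> continuous (fun u => gradient f u 0 i).
Proof.
move=> [_ lip] u; apply/(@cvgrPdist_lt _ _ _ (nbhs u)) => e e0.
have : (fun w => L * enorm (u - w)) @ (nbhs u) --> (0 : R).
  rewrite (_ : 0 = L * enorm (u - u)).
    apply: (@cvgM _ _ (nbhs u) _ (fun=> L)); first exact: cvg_cst.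
    apply: (@cvg_comp _ _ _ (fun w : 'rV[R]_n => u - w) (@enorm R n) (nbhs u));
      last exact: enorm_continuous.
    by apply: (@cvgB _ _ _ (nbhs u) _ (fun=> u) id); [exact: cvg_cst|exact: cvg_id].
  rewrite subrr /enorm big1 ?sqrtr0 ?mulr0 // => j _.
  by rewrite mxE expr0n.
move=> /(@cvgrPdist_lt _ _ _ (nbhs u)) /(_ e e0); apply: filterS => w.
rewrite sub0r normrN; apply: le_lt_trans.
apply: le_trans (le_trans (lip u w) (ler_norm _)).
have subE (a b : 'rV[R]_n) : (a - b) 0 i = a 0 i - b 0 i by rewrite !mxE.
by rewrite -subE; exact: coord_le_enorm.
Qed.

Lemma measurable_gradient (R : realType) n (L : R) (f : 'rV[R]_n -> R) :
  smooth L f ->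
  measurable_fun setT (fun u : borel_rV R n => (gradient f u : borel_rV R n)).
Proof.
move=> sf; apply: measurable_fun_rV => i; apply: continuous_borel_measurable.
exact: gradient_coord_continuous sf.
Qed.

Lemma measurable_enorm (R : realType) n :
  measurable_fun setT (fun u : borel_rV R n => enorm u).
Proof. by apply: continuous_borel_measurable; exact: enorm_continuous. Qed.

(** * Integration against a density *)

Section density.
Context d (T : measurableType d) (R : realType).
Variables (mu nu : {measure set T -> \bar R}) (p : T -> R).
Hypotheses (mp : measurable_fun setT p) (p0 : forall x, 0 <= p x).
Hypothesis nuE : forall A, measurable A -> nu A = (\int[mu]_(x in A) (p x)%:E)%E.
Local Open Scope ereal_scope.
Import HBNNSimple.

Let mpE : measurable_fun setT (fun x => (p x)%:E).
Proof. exact/measurable_EFinP. Qed.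

Let density_nnsfun (f : {nnsfun T >-> R}) :
  \int[nu]_x (f x)%:E = \int[mu]_x ((f x)%:E * (p x)%:E).
Proof.
under [LHS]eq_integral do rewrite fimfunE -fsumEFin//.
rewrite [LHS]ge0_integral_fsum//; last 2 first.
  - by move=> r; exact/measurable_EFinP/measurableT_comp.
  - by move=> n x _; rewrite EFinM nnfun_muleindic_ge0.
under [RHS]eq_integral.
  move=> x xD; rewrite fimfunE -fsumEFin// muleC ge0_mule_fsumr; last first.
    by move=> r; rewrite EFinM nnfun_muleindic_ge0.
  over.
rewrite [RHS]ge0_integral_fsum//; last 2 first.
  - move=> r; apply: emeasurable_funM => //.
    by apply/measurable_EFinP/measurableT_comp.
  - move=> n x _; rewrite mule_ge0 ?lee_fin//.
    by have := nnfun_muleindic_ge0 f n x; rewrite -EFinM lee_fin.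
(* Level set by level set; a value [r] taken by [f] is nonnegative. *)
apply: eq_fsbigr => r /[!inE] -[x0 _ fx0]; have r0 : (0 <= r)%R by rewrite -fx0.
under [RHS]eq_integral do rewrite EFinM muleCA.
rewrite integralZl_indic_nnsfun// integral_indic// setIT nuE//.
rewrite ge0_integralZl ?lee_fin//; last 2 first.
  - by apply: emeasurable_funM => //; exact/measurable_EFinP.
  - by move=> x _; rewrite mule_ge0 ?lee_fin.
congr (_ * _); rewrite integral_mkcond; apply: eq_integral => x _.
by rewrite patchE indicE; case: (x \in _); rewrite ?mule1 ?mule0.
Qed.

(** Both sides are linear and continuous under monotone limits, and they agree on
    indicators by the assumption that [p] is a density. *)
Lemma integral_density (f : T -> \bar R) :
  measurable_fun setT f -> (forall x, 0 <= f x) ->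
  \int[nu]_x f x = \int[mu]_x (f x * (p x)%:E).
Proof.
move=> mf f0; pose f_ := nnsfun_approx measurableT mf.
transitivity (lim (\int[nu]_x (f_ n x)%:E @[n --> \oo])).
  rewrite -monotone_convergence//=.
  - apply: eq_integral => ? /[!inE] xD; apply/esym/cvg_lim => //=.
    exact: cvg_nnsfun_approx.
  - by move=> n; exact/measurable_EFinP/measurable_funTS.
  - by move=> n ? _; rewrite lee_fin.
  - by move=> ? _ ? ? mn; rewrite lee_fin; exact/lefP/nd_nnsfun_approx.
rewrite [RHS](_ : _ = lim (\int[mu]_x ((f_ n x)%:E * (p x)%:E) @[n --> \oo])); last first.
  rewrite -monotone_convergence//=.
  - apply: eq_integral => x /[!inE] xD; apply/esym/cvg_lim => //.
    apply: cvgeZr => //; exact: cvg_nnsfun_approx.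
  - by move=> n; apply: emeasurable_funM => //; exact/measurable_EFinP.
  - by move=> n ? _; rewrite mule_ge0 ?lee_fin.
  - move=> ? _ ? ? mn; apply: lee_wpmul2r; rewrite lee_fin//.
    exact/lefP/nd_nnsfun_approx.
by under eq_fun do rewrite density_nnsfun.
Qed.

End density.

Lemma integral_normal_probE (R : realType) (m s : R) (f : R -> \bar R) :
  measurable_fun setT f -> (forall x, 0 <= f x)%E ->
  (\int[normal_prob m s]_x f x =
   \int[lebesgue_measure]_x (f x * (normal_pdf m s x)%:E))%E.
Proof.
move=> mf f0; apply: integral_density => //.
- exact: measurable_normal_pdf.
- by move=> x; exact: normal_pdf_ge0.
Qed.

(** * The standard Gaussian measure as an iterated product *)

(** The law of [n] independent centred normal variables of standard deviation
    [s > 0].  The recursion follows that of [integral_rV], so that Gaussian integrals can be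
    computed one coordinate at a time by Tonelli. *)
Fixpoint iid_normal (R : realType) (s : R) (n : nat) : probability (borel_rV R n) R :=
  match n with
  | 0 => @dirac _ (borel_rV R 0) (0 : 'rV[R]_0) R
  | m.+1 => distribution ((normal_prob 0 s \x iid_normal s m)%E) (@cons_rV R m)
  end.

Lemma integral_iid_normalS (R : realType) (s : R) n (f : borel_rV R n.+1 -> \bar R) :
  measurable_fun setT f -> (forall x, 0 <= f x)%E ->
  (\int[iid_normal s n.+1]_x f x =
   \int[normal_prob 0 s]_x \int[iid_normal s n]_y f (cons_rV (x, y)))%E.
Proof.
move=> mf f0; rewrite /= ge0_integral_distribution//.
rewrite (fubini_tonelli1 (f \o @cons_rV R n)) //.
by apply: measurableT_comp => //; exact: measurable_cons_rV.
by move=> x; exact: f0.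
Qed.

(** Stated for every integrand rather than for indicators, because the induction
    applies it to sections of [f] multiplied by the density of the first
    coordinate. *)
Lemma integral_rV_iid_normal (R : realType) (s : R) n (f : borel_rV R n -> \bar R) :
  measurable_fun setT f -> (forall x, 0 <= f x)%E ->
  (integral_rV (fun x : 'rV[R]_n => f x * (\prod_(i < n) normal_pdf 0 s (x ord0 i))%:E) =
   \int[iid_normal s n]_x f x)%E.
Proof.
elim: n f => [|n IH] f mf f0.
  by rewrite /= big_ord0 mule1 integral_dirac // diracT mul1e.
rewrite integral_iid_normalS //.
have mfc : measurable_fun setT (f \o @cons_rV R n).
  by apply: measurableT_comp => //; exact: measurable_cons_rV.
rewrite integral_normal_probE; last 2 first.
- by apply: (measurable_fun_fubini_tonelli_F (f \o @cons_rV R n)) => // x; exact: f0.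
- by move=> x; apply: integral_ge0 => y _; exact: f0.
rewrite /=; apply: eq_integral => x _.
have -> : (fun y : 'rV[R]_n => f (row_mx (x%:M : 'rV[R]_1) y : 'rV[R]_n.+1) *
   (\prod_(i < n.+1) normal_pdf 0 s ((row_mx (x%:M : 'rV[R]_1) y : 'rV[R]_n.+1) ord0 i))%:E)%E =
  (fun y : 'rV[R]_n => (f (cons_rV (x, y)) * (normal_pdf 0 s x)%:E) * (\prod_(i < n) normal_pdf 0 s (y ord0 i))%:E)%E.
  apply/funext => y; rewrite -muleA; congr (_ * _)%E; rewrite -EFinM; congr (_%:E).
  rewrite big_ord_recl; congr (_ * _).
    by congr normal_pdf; exact: (cons_rV_coord0 x y).
  apply: eq_bigr => i _; congr normal_pdf.
  exact: (cons_rV_coordS x y i).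
have mf1 : measurable_fun setT (fun y => f (cons_rV (x, y))).
  exact: (measurable_fun_pair2 x mfc).
rewrite (IH (fun y => (f (cons_rV (x, y)) * (normal_pdf 0 s x)%:E)%E)).
- by rewrite ge0_integralZr // lee_fin normal_pdf_ge0.
- exact: emeasurable_funM.
- by move=> y; rewrite mule_ge0 // lee_fin normal_pdf_ge0.
Qed.

Lemma gaussian_pdf_scalar (R : realType) (s : R) n (x : 'rV[R]_n) : 0 < s ->
  gaussian_pdf 0 ((s ^+ 2)%:M) x = \prod_(i < n) normal_pdf 0 s (x ord0 i).
Proof.
move=> s0; have sN0 : s != 0 by rewrite gt_eqF.
rewrite /gaussian_pdf subr0.
under [RHS]eq_bigr do rewrite normal_pdfE //.
rewrite big_split /= prodr_const card_ord; congr (_ * _).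
  rewrite /normal_peak exprVn; congr (_^-1).
  rewrite det_scalar -exprMn (_ : 2 * pi * s ^+ 2 = s ^+ 2 * pi *+ 2); last by ring.
  elim: n {x} => [|n IH]; first by rewrite !expr0 sqrtr1.
  rewrite [LHS](congr1 _ (exprS _ _)) [RHS]exprS sqrtrM ?IH //.
  by rewrite mulrn_wge0 // mulr_ge0 // ?pi_ge0 // sqr_ge0.
rewrite invmx_scalar mul_mx_scalar -scalemxAl !mxE.
rewrite /normal_fun -expR_sum; congr expR.
rewrite mulrAC mulr_sumr -sumrN; apply: eq_bigr => i _.
by rewrite !mxE subr0 -mulr_natr; field.
Qed.

(** The density of a Gaussian vector with scalar covariance is a product of
    one-dimensional densities. *)
Lemma gaussian_vector_distribution (R : realType) (s : R) n d (Omega : measurableType d)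
    (P : probability Omega R) (X : {RV P >-> borel_rV R n}) : 0 < s ->
  gaussian_vector 0 ((s ^+ 2)%:M) X ->
  forall A, measurable A -> distribution P X A = iid_normal s n A.
Proof.
move=> s0 hX A mA; rewrite hX //.
transitivity (\int[iid_normal s n]_x (\1_A x)%:E)%E; last first.
  by rewrite integral_indic // setIT.
rewrite -integral_rV_iid_normal; last 2 first.
- exact/measurable_EFinP.
- by move=> x; rewrite lee_fin.
congr integral_rV; apply/funext => x.
by rewrite gaussian_pdf_scalar // mulrC EFinM.
Qed.

(** * Affine images and sums of normal laws *)

(** Both sides are measures in [A] and they agree on half-open intervals. *)
Lemma lebesgue_measure_affine (R : realType) (a b : R) (A : set R) : 0 < a ->
  measurable A ->
  lebesgue_measure A =
  (a%:E * lebesgue_measure ((fun x : R => (a * x + b)%R) @^-1` A))%E.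
Proof.
move=> a0 mA.
have maff : @measurable_fun _ _ (measurableTypeR R) (measurableTypeR R) setT
    (fun x => a * x + b).
  by apply: measurable_funD => //; exact: measurable_funM.
pose aff : measurableTypeR R -> measurableTypeR R := fun x => a * x + b.
pose nu_ : {measure set (measurableTypeR R) -> \bar R} :=
  mscale (NngNum (ltW a0)) (pushforward lebesgue_measure aff).
pose nu := nu_ maff.
suff nuE X : ocitv X -> lebesgue_measure X = nu X.
  exact: (lebesgue_measure_unique nuE mA).
move=> [[u v] /= uv] <-.
rewrite /mscale /= /pushforward.
rewrite [X in _ = (_ * lebesgue_measure X)%E](_ : _ = `](u - b) / a, (v - b) / a]%classic).
  rewrite !lebesgue_measure_itv /= !lte_fin ltr_pM2r ?invr_gt0 // ltrD2r.
  case: ifP => _; last by rewrite mule0.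
  by rewrite -!EFinB -EFinM; congr (_%:E); field; rewrite gt_eqF.
apply/seteqP; split=> x /=; rewrite !in_itv /=;
  by rewrite ltr_pdivrMr // ler_pdivlMr // ltrBlDr lerBrDr [x * a]mulrC.
Qed.

Lemma ge0_integral_affine (R : realType) (a b : R) (f : R -> \bar R) : 0 < a ->
  measurable_fun setT f -> (forall x, 0 <= f x)%E ->
  (\int[lebesgue_measure]_x f x =
   \int[lebesgue_measure]_x (f (a * x + b)%R * a%:E))%E.
Proof.
move=> a0 mf f0.
have maff : @measurable_fun _ _ (measurableTypeR R) (measurableTypeR R) setT
    (fun x => a * x + b).
  by apply: measurable_funD => //; exact: measurable_funM.
pose aff : measurableTypeR R -> measurableTypeR R := fun x => a * x + b.
pose nu_ : {measure set (measurableTypeR R) -> \bar R} :=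
  mscale (NngNum (ltW a0)) (pushforward lebesgue_measure aff).
pose nu := nu_ maff.
rewrite (eq_measure_integral nu); last first.
  by move=> A mA _; exact: lebesgue_measure_affine.
rewrite ge0_integral_mscale //= ge0_integral_pushforward //=.
rewrite preimage_setT muleC -ge0_integralZr //.
  exact: (measurableT_comp mf maff).
by rewrite lee_fin ltW.
Qed.

Lemma ge0_integral_opp (R : realType) (f : R -> \bar R) :
  measurable_fun setT f -> (forall x, 0 <= f x)%E ->
  (\int[lebesgue_measure]_x f (- x)%R = \int[lebesgue_measure]_x f x)%E.
Proof.
move=> mf f0; rewrite [RHS](eq_measure_integral
  (pushforward lebesgue_measure (-%R : measurableTypeR R -> measurableTypeR R))).
  by rewrite ge0_integral_pushforward.
by move=> A mA _; exact/esym/lebesgue_measureN.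
Qed.

Lemma normal_pdf_affine (R : realType) (a b m s x : R) : a != 0 -> s != 0 ->
  normal_pdf (a * m + b) (a * s) (a * x + b) * `|a| = normal_pdf m s x.
Proof.
move=> a0 s0; rewrite !normal_pdfE ?mulf_neq0 //.
rewrite mulrAC; congr (_ * _).
  rewrite /normal_peak (_ : (a * s) ^+ 2 * pi *+ 2 = a ^+ 2 * (s ^+ 2 * pi *+ 2)); last first.
    by ring.
  by rewrite sqrtrM ?sqr_ge0 // sqrtr_sqr invfM mulrAC mulVf ?mul1r ?normr_eq0.
by rewrite /normal_fun; congr expR; field; rewrite s0 a0.
Qed.

(** A negative slope is reduced to a positive one by the invariance of the Lebesgue
    measure under reflection.  The standard deviation [a * s] may thus be negative,
    which is harmless since only its square occurs in the density. *)
Lemma integral_normal_affine (R : realType) (a b m s : R) (f : R -> \bar R) :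
  a != 0 -> s != 0 -> measurable_fun setT f -> (forall x, 0 <= f x)%E ->
  (\int[normal_prob m s]_x f (a * x + b)%R =
   \int[normal_prob (a * m + b) (a * s)]_x f x)%E.
Proof.
move=> a0 s0 mf f0.
have maff c : measurable_fun setT (fun x : R => c * x + b).
  by apply: measurable_funD => //; exact: measurable_funM.
rewrite (@integral_normal_probE _ m s (fun x => f (a * x + b))); last 2 first.
- exact: (measurableT_comp mf (maff a)).
- by move=> x; exact: f0.
rewrite (@integral_normal_probE _ _ _ f mf f0).
have mg : measurable_fun setT
    (fun x => f x * (normal_pdf (a * m + b) (a * s) x)%:E)%E.
  by apply: emeasurable_funM => //; apply/measurable_EFinP; exact: measurable_normal_pdf.
have g0 x : (0 <= f x * (normal_pdf (a * m + b) (a * s) x)%:E)%E.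
  by rewrite mule_ge0 // lee_fin normal_pdf_ge0.
rewrite [RHS](@ge0_integral_affine _ `|a| b) ?normr_gt0 //.
under eq_integral do rewrite -(normal_pdf_affine b m _ a0 s0) EFinM muleA.
have [a1|a1] := leP 0 a; first by rewrite ger0_norm.
rewrite (ltr0_norm a1); symmetry.
set h := (X in (\int[_]_x X x)%E); set k := (X in _ = (\int[_]_x X x)%E).
rewrite (_ : h = fun x => k (- x)); last first.
  by apply/funext => x; rewrite /h /k mulrN mulNr.
apply: ge0_integral_opp.
- by apply: emeasurable_funM => //; exact: (measurableT_comp mg (maff _)).
- by move=> x; rewrite mule_ge0 // lee_fin oppr_ge0 ltW.
Qed.

(** Bayes rule for two normal variables: the joint density of a sum and of one of its
    terms, as the density of the sum times that of the term given the sum. *)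
Lemma normal_pdf_complete_square (R : realType) (s t x y : R) : s != 0 -> t != 0 ->
  let r := Num.sqrt (s ^+ 2 + t ^+ 2) in
  normal_pdf y s x * normal_pdf 0 t y =
  normal_pdf 0 r x * normal_pdf (t ^+ 2 / r ^+ 2 * x) (s * t / r) y.
Proof.
move=> s0 t0 r.
have st0 : 0 < s ^+ 2 + t ^+ 2 by rewrite addr_gt0 // exprn_even_gt0.
have r0 : 0 < r by rewrite sqrtr_gt0.
have r2 : r ^+ 2 = s ^+ 2 + t ^+ 2 by rewrite sqr_sqrtr // ltW.
have rN0 : r != 0 by rewrite gt_eqF.
rewrite !normal_pdfE ?mulf_neq0 ?invr_neq0 // /normal_peak /normal_fun.
rewrite mulrACA [RHS]mulrACA -!expRD; congr (_ * expR _).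
  rewrite -!invfM; congr (_^-1).
  have pos z : 0 <= z ^+ 2 * pi *+ 2 :> R.
    by rewrite mulrn_wge0 // mulr_ge0 ?pi_ge0 ?sqr_ge0.
  rewrite -!sqrtrM; [|exact: pos|exact: pos].
  by congr Num.sqrt; field.
rewrite !subr0.
rewrite (_ : (s * t / r) ^+ 2 = s ^+ 2 * t ^+ 2 / r ^+ 2); last by field.
rewrite r2; field.
by rewrite s0 t0 gt_eqF.
Qed.

(** After Tonelli, the inner integral over [y] of the product of the two densities is
    the density of the sum: by [normal_pdf_complete_square] its other factor is a
    normal density in [y], of total mass one. *)
Lemma normal_convolution (R : realType) (s t : R) (f : R -> \bar R) :
  s != 0 -> t != 0 ->
  measurable_fun setT f -> (forall x, 0 <= f x)%E ->
  (\int[normal_prob 0 t]_y \int[normal_prob 0 s]_x f (x + y)%R =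
   \int[normal_prob 0 (Num.sqrt (s ^+ 2 + t ^+ 2))]_x f x)%E.
Proof.
move=> s0 t0 mf f0; set r := Num.sqrt _.
have mpdf : measurable_fun setT
    (fun yx : R * R => normal_pdf yx.1 s yx.2).
  rewrite /normal_pdf (negbTE s0).
  apply: measurable_funM => //; apply: measurableT_comp => //=.
  apply: measurable_funM => //=; apply: measurableT_comp => //=.
  by apply: measurable_funX => //=; apply: measurable_funB.
(* Absorbing the shift by [y] into the mean of the density leaves [f x] free of
   [y], so that it comes out of the inner integral once the order is exchanged. *)
pose h (yx : measurableTypeR R * measurableTypeR R) :=
  (f yx.2 * (normal_pdf yx.1 s yx.2)%:E)%E.
have h0 yx : (0 <= h yx)%E by rewrite mule_ge0 // lee_fin normal_pdf_ge0.
have mh : measurable_fun setT h.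
  apply: emeasurable_funM; first exact: (measurableT_comp mf).
  exact/measurable_EFinP.
transitivity (\int[normal_prob 0 t]_y \int[lebesgue_measure]_x h (y, x))%E.
  apply: eq_integral => y _.
  have := @integral_normal_affine R 1 y 0 s f (oner_neq0 _) s0 mf f0.
  rewrite mulr0 add0r mul1r (@integral_normal_probE _ _ _ f mf f0) => <-.
  by apply: eq_integral => x _; rewrite mul1r.
rewrite (fubini_tonelli h mh h0) (@integral_normal_probE _ _ _ f mf f0).
apply: eq_integral => x _; rewrite /h /=.
rewrite integral_normal_probE; last 2 first.
- exact: (measurable_fun_pair1 x mh).
- by move=> y; exact: (h0 (y, x)).
under eq_integral do rewrite -muleA -EFinM normal_pdf_complete_square //
  EFinM muleA.
rewrite ge0_integralZl; first last.
- by rewrite mule_ge0 // lee_fin normal_pdf_ge0.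
- by move=> y _; rewrite lee_fin normal_pdf_ge0.
- by apply/measurable_EFinP; exact: measurable_normal_pdf.
- exact: measurableT.
by rewrite integral_normal_pdf mule1.
Qed.

Lemma ge0_integral_prob_cst d (T : measurableType d) (R : realType)
  (P : probability T R) (c : \bar R) : (\int[P]_x c = c)%E.
Proof. by rewrite (integral_cst P measurableT c) /= probability_setT mule1. Qed.

Lemma normal_probN (R : realType) (m s : R) : normal_prob m (- s) = normal_prob m s.
Proof.
apply/funext => A; apply: eq_integral => x _.
by rewrite /normal_pdf oppr_eq0 /normal_peak /normal_fun sqrrN.
Qed.

Lemma integral_normal_probN (R : realType) (m s : R) (f : R -> \bar R) :
  (\int[normal_prob m (- s)]_x f x = \int[normal_prob m s]_x f x)%E.
Proof. by apply: eq_measure_integral => A _ _; exact: (congr1 (@^~ A) (normal_probN m s)). Qed.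

Lemma integral_normal_abs (R : realType) (a s : R) (f : R -> \bar R) : s != 0 ->
  measurable_fun setT f -> (forall x, 0 <= f x)%E ->
  (\int[normal_prob 0 s]_x f (a * x)%R = \int[normal_prob 0 s]_x f (`|a| * x)%R)%E.
Proof.
move=> s0 mf f0; have [a0|a0] := leP 0 a; first by rewrite ger0_norm.
rewrite (ltr0_norm a0).
have mfa : measurable_fun setT (fun x => f (- a * x)).
  by apply: (measurableT_comp mf); exact: measurable_funM.
have := @integral_normal_affine _ (-1) 0 0 s (fun x => f (- a * x)).
rewrite oppr_eq0 oner_neq0 mulr0 addr0 mulN1r => /(_ isT s0 mfa (fun=> f0 _)) E.
transitivity (\int[normal_prob 0 (- s)]_x f (- a * x)%R)%E.
  by rewrite -E; apply: eq_integral => x _; rewrite addr0 mulN1r mulrNN.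
exact: integral_normal_probN.
Qed.

(** Stability of the normal law, with degenerate coefficients allowed so that it can be
    iterated over the coordinates of an arbitrary vector. *)
Lemma normal_two_stable (R : realType) (s a b : R) (f : R -> \bar R) : s != 0 ->
  measurable_fun setT f -> (forall x, 0 <= f x)%E ->
  (\int[normal_prob 0 s]_x \int[normal_prob 0 s]_y f (a * x + b * y)%R =
   \int[normal_prob 0 s]_x f (Num.sqrt (a ^+ 2 + b ^+ 2) * x)%R)%E.
Proof.
move=> s0 mf f0.
have [->|b0] := eqVneq b 0.
  rewrite expr0n addr0 sqrtr_sqr -integral_normal_abs //.
  under eq_integral do (under eq_integral do rewrite mul0r addr0;
    rewrite ge0_integral_prob_cst).
  by [].
have [->|a0] := eqVneq a 0.
  rewrite expr0n add0r sqrtr_sqr -integral_normal_abs //.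
  under eq_integral do (under eq_integral do rewrite mul0r add0r).
  by rewrite ge0_integral_prob_cst.
have mfD (c : R) : measurable_fun setT (fun x : R => f (c + x)).
  by apply: (measurableT_comp mf); exact: measurable_funD.
have scale c (g : R -> \bar R) : c != 0 -> measurable_fun setT g ->
    (forall x, 0 <= g x)%E ->
    (\int[normal_prob 0 s]_x g (c * x)%R = \int[normal_prob 0 (c * s)]_x g x)%E.
  move=> c0 mg g0.
  have := @integral_normal_affine _ c 0 0 s g c0 s0 mg g0.
  rewrite mulr0 addr0 => <-.
  by apply: eq_integral => x _; rewrite addr0.
transitivity (\int[normal_prob 0 s]_x \int[normal_prob 0 (b * s)]_y f (a * x + y)%R)%E.
  by apply: eq_integral => x _; rewrite (scale b (fun y => f (a * x + y))%R).
transitivity (\int[normal_prob 0 (a * s)]_x \int[normal_prob 0 (b * s)]_y f (y + x)%R)%E.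
  rewrite -(scale a (fun x => \int[normal_prob 0 (b * s)]_y f (y + x)%R)%E) //.
  - by apply: eq_integral => x _; apply: eq_integral => y _; rewrite addrC.
  - pose h (xy : measurableTypeR R * measurableTypeR R) := f (xy.2 + xy.1).
    have mh : measurable_fun setT h.
      apply: (measurableT_comp mf); apply: measurable_funD.
        exact: measurable_snd.
      exact: measurable_fst.
    exact: (measurable_fun_fubini_tonelli_F h mh (fun=> f0 _)).
  - by move=> x; apply: integral_ge0 => y _; exact: f0.
apply: etrans
  (normal_convolution (mulf_neq0 b0 s0) (mulf_neq0 a0 s0) mf f0) _.
set r := Num.sqrt (a ^+ 2 + b ^+ 2).
have r0 : r != 0 by rewrite gt_eqF // sqrtr_gt0 addr_gt0 // exprn_even_gt0.
rewrite (scale r f r0 mf f0).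
have -> : Num.sqrt ((b * s) ^+ 2 + (a * s) ^+ 2) = r * `|s|.
  by rewrite -sqrtr_sqr -sqrtrM ?addr_ge0 ?sqr_ge0 //; congr Num.sqrt; ring.
have [s1|s1] := leP 0 s; first by rewrite (ger0_norm s1).
by rewrite (ltr0_norm s1) mulrN; exact: integral_normal_probN.
Qed.

(** * Moments of the normal law *)

Lemma is_derive_gaussian (R : realType) (c k x : R) :
  is_derive x (1 : R) (fun x => c * expR (k * x ^+ 2)) (2 * k * x * (c * expR (k * x ^+ 2))).
Proof.
have H0 := @is_deriveX _ _ (@id R) 2 x 1 1 (is_derive_id x 1).
have H1 : is_derive x (1:R) (fun x : R => k * x ^+ 2) (2 * k * x).
  apply: is_derive_eq (is_deriveZ k H0) _.
  by rewrite /GRing.scale /=; ring.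
have H2 := @is_derive1_comp _ expR (fun x : R => k * x ^+ 2) x _ _ (is_derive_expR _) H1.
apply: is_derive_eq (is_deriveZ c H2) _.
by rewrite /GRing.scale /=; ring.
Qed.

(** By symmetry it is twice the integral over the positive half-line, where the
    integrand has the primitive [- s ^+ 2] times the density. *)
Lemma integral_normal_norm (R : realType) (s : R) : 0 < s ->
  (\int[normal_prob 0 s]_x `|x|%:E = (2 * s / Num.sqrt (2 * pi))%:E)%E.
Proof.
move=> s0; have sN0 : s != 0 by rewrite gt_eqF.
rewrite integral_normal_probE; last 2 first.
- by apply/measurable_EFinP; exact: normr_measurable.
- by move=> x; rewrite lee_fin.
under eq_integral do rewrite -EFinM.
have cpdf := continuous_normal_pdf (m := 0) sN0.
have cf : continuous (fun x : R => `|x| * normal_pdf 0 s x).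
  move=> x; apply: cvgM; last exact: cpdf.
  exact: norm_continuous.
rewrite ge0_symfun_integralT //; last 2 first.
- by move=> x; rewrite mulr_ge0 // normal_pdf_ge0.
- by move=> x; rewrite /= normrN !normal_pdfE // /normal_fun !subr0 sqrrN.
rewrite -set_itvcy.
pose c := - s ^+ 2 * normal_peak s; pose k : R := - (s ^+ 2 *+ 2)^-1.
have pdfE x : normal_pdf 0 s x = normal_peak s * expR (k * x ^+ 2).
  by rewrite normal_pdfE // /normal_fun subr0 /k; congr (_ * expR _); rewrite !mulNr mulrC.
rewrite (_ : \int[_]_(_ in _) _ = (0 - c)%:E)%E; last first.
  have dF x := is_derive_gaussian c k x.
  have -> : (0 - c)%:E = (0%:E - (c * expR (k * 0 ^+ 2))%:E)%E.
    by rewrite expr0n mulr0 expR0 mulr1 EFinB.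
  apply: (@ge0_continuous_FTC2y _ (fun x : R => `|x| * normal_pdf 0 s x)
    (fun x => c * expR (k * x ^+ 2)) 0 0).
  - by move=> x x0; rewrite mulr_ge0 // normal_pdf_ge0.
  - exact: continuous_subspaceT.
  - rewrite -(mulr0 c); apply: cvgM; first exact: cvg_cst.
    have -> : (fun x : R => expR (k * x ^+ 2)) = (fun y => expR (- y)) \o (fun x => x ^+ 2 * (- k)).
      by apply/funext => x /=; rewrite mulrN opprK mulrC.
    apply: (cvg_comp _ (fun y => expR (- y))); last exact: cvgr_expR.
    apply: gt0_cvgMly cvgr_expr2.
    by rewrite opprK invr_gt0 mulrn_wgt0 // exprn_gt0.
  - by move=> x _; exact: (@ex_derive _ _ _ _ _ _ _ (dF x)).
  - apply: cvg_at_right_filter.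
    have /derivable1_diffP := @ex_derive _ _ _ _ _ _ _ (dF 0).
    exact: differentiable_continuous.
  - move=> x; rewrite in_itv /= andbT => x0.
    rewrite derive1E (@derive_val _ _ _ _ _ _ _ (dF x)) pdfE ger0_norm ?ltW //.
    rewrite /c /k; field; exact: sN0.
rewrite sub0r -EFinM; congr (_%:E).
rewrite /c mulNr opprK /normal_peak.
have -> : s ^+ 2 * pi *+ 2 = s ^+ 2 * (2 * pi) by ring.
rewrite sqrtrM ?sqr_ge0 // sqrtr_sqr ger0_norm ?ltW //.
field.
by rewrite sN0 gt_eqF // sqrtr_gt0 mulr_gt0 // pi_gt0.
Qed.

(** The integrand times the density of deviation [s] is, up to the factor [q^-1], the
    density of deviation [s / q]. *)
Lemma integral_normal_exp_sqr (R : realType) (s q : R) : 0 < s -> 0 < q ->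
  (\int[normal_prob 0 s]_x (expR ((1 - q ^+ 2) / (2 * s ^+ 2) * x ^+ 2))%:E =
   (q^-1)%:E)%E.
Proof.
move=> s0 q0; have sN0 : s != 0 by rewrite gt_eqF.
have qN0 : q != 0 by rewrite gt_eqF.
have mexp : measurable_fun setT
    (fun x : R => (expR ((1 - q ^+ 2) / (2 * s ^+ 2) * x ^+ 2))%:E).
  apply/measurable_EFinP; apply: continuous_measurable_fun => x.
  apply: (cvg_comp _ expR); last exact: continuous_expR.
  by apply: cvgM; [exact: cvg_cst|exact: sqr_continuous].
rewrite (integral_normal_probE _ _ mexp); last by move=> x; rewrite lee_fin expR_ge0.
have E x : expR ((1 - q ^+ 2) / (2 * s ^+ 2) * x ^+ 2) * normal_pdf 0 s x =
    q^-1 * normal_pdf 0 (s / q) x.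
  rewrite !normal_pdfE ?mulf_neq0 ?invr_neq0 // /normal_fun !subr0.
  rewrite mulrCA -expRD [RHS]mulrA; congr (_ * expR _); last by field; rewrite sN0 qN0.
  rewrite /normal_peak (_ : (s / q) ^+ 2 * pi *+ 2 = (q ^-1) ^+ 2 * (s ^+ 2 * pi *+ 2)); last first.
    by field.
  by rewrite sqrtrM ?sqr_ge0 // sqrtr_sqr gtr0_norm ?invr_gt0 // invfM mulrA mulfV ?mul1r ?invr_neq0.
under eq_integral do rewrite -EFinM E EFinM.
rewrite ge0_integralZl; first last.
- by rewrite lee_fin invr_ge0 ltW.
- by move=> y _; rewrite lee_fin normal_pdf_ge0.
- by apply/measurable_EFinP; exact: measurable_normal_pdf.
- exact: measurableT.
by rewrite integral_normal_pdf mule1.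
Qed.

(** No integration by parts: [1 + a x^2 <= exp (a x^2)] bounds the second moment by
    [2 s^2 / (q (1 + q))] for every [q] in [(0, 1)], through
    [integral_normal_exp_sqr]; as [q] tends to [1] this tends to [s^2]. *)
Lemma integral_normal_sqr_le (R : realType) (s : R) : 0 < s ->
  (\int[normal_prob 0 s]_x (x ^+ 2)%:E <= (s ^+ 2)%:E)%E.
Proof.
move=> s0; set M := (\int[_]_x _)%E.
have msqr : measurable_fun setT (fun x : R => x ^+ 2).
  by apply: continuous_measurable_fun; exact: sqr_continuous.
have M0 : (0 <= M)%E by apply: integral_ge0 => x _; rewrite lee_fin sqr_ge0.
have H (q : R) : 0 < q -> q < 1 ->
    (1 + ((1 - q ^+ 2) / (2 * s ^+ 2))%:E * M <= (q^-1)%:E)%E.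
  move=> q0 q1; set a := _ / _.
  have a0 : 0 <= a.
    apply: divr_ge0; last by apply: mulr_ge0 => //; exact: sqr_ge0.
    by rewrite subr_ge0 exprn_ile1 // ltW.
  rewrite -(integral_normal_exp_sqr s0 q0) /M.
  rewrite -(ge0_integral_prob_cst (normal_prob 0 s) 1%E).
  rewrite -ge0_integralZl //; last 2 first.
  - exact/measurable_EFinP.
  - by move=> x _; rewrite lee_fin sqr_ge0.
  rewrite -ge0_integralD //; last 2 first.
  - by move=> x _; rewrite -EFinM lee_fin mulr_ge0 ?sqr_ge0.
  - by apply/measurable_EFinP; apply: measurable_funM.
  apply: ge0_le_integral => //.
  - by move=> x _; rewrite -EFinM -EFinD lee_fin addr_ge0 // mulr_ge0 ?sqr_ge0.
  - by apply/measurable_EFinP; apply: measurable_funD => //; apply: measurable_funM.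
  - apply/measurable_EFinP; apply: measurableT_comp => //; exact: measurable_funM.
  - by move=> x _; rewrite -EFinM -EFinD lee_fin expR_ge1Dx.
(* Any fixed [q] in (0, 1) shows finiteness. *)
have : (M < +oo)%E.
  have h0 : (0 : R) < 2^-1 by rewrite invr_gt0.
  have h1 : (2^-1 : R) < 1 by rewrite invf_lt1 // ltr1n.
  have := H _ h0 h1; move: M0; case: (M) => [r| |] // _; first by rewrite ltry.
  rewrite gt0_muley // lte_fin divr_gt0 // ?mulr_gt0 ?exprn_gt0 //.
  by rewrite subr_gt0 exprn_ilt1 // ltW.
move: M0 H; case: M => [r| |] // r0 H _; rewrite lee_fin; rewrite lee_fin in r0.
rewrite leNgt; apply/negP => sr.
have rpos : 0 < r by apply: lt_trans sr; rewrite exprn_gt0.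
set w := s ^+ 2 in sr H.
have w0 : 0 < w by rewrite exprn_gt0.
(* The midpoint of [w / r] and [1], at which [q * (1 + q) > 2 * w / r]. *)
pose q := (r + w) / (2 * r).
have q0 : 0 < q by rewrite divr_gt0 ?addr_gt0 ?mulr_gt0.
have q1 : q < 1 by rewrite ltr_pdivrMr ?mulr_gt0 //; lra.
have := H q q0 q1; rewrite -EFinM -EFinD lee_fin.
have -> : 1 + (1 - q ^+ 2) / (2 * w) * r = q^-1 + (1 - q) / q * ((1 + q) * q * r / (2 * w) - 1).
  by field; rewrite !gt_eqF.
rewrite gerDl leNgt; apply/negP/negPn.
apply: mulr_gt0; first by rewrite divr_gt0 // subr_gt0.
rewrite subr_gt0 ltr_pdivlMr ?mulr_gt0 // mul1r.
rewrite /q (_ : _ * r = (3 * r + w) * (r + w) / (4 * r)); last by field; rewrite gt_eqF.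
rewrite ltr_pdivlMr ?mulr_gt0 // -subr_gt0.
rewrite (_ : _ - _ = (3 * r - w) * (r - w)); last by ring.
by rewrite mulr_gt0 // subr_gt0 //; lra.
Qed.

(** * Linear images and symmetry of the Gaussian measure *)

Lemma measurable_dotp (R : realType) n (g : 'rV[R]_n) :
  measurable_fun setT (fun x : borel_rV R n => dotp g x).
Proof.
apply: measurable_sum => i; apply: measurable_funM => //.
exact: measurable_coord.
Qed.

Lemma integral_iid_normal0 (R : realType) (s : R) (f : borel_rV R 0 -> \bar R) :
  measurable_fun setT f -> (\int[iid_normal s 0]_y f y = f (0%R : 'rV[R]_0))%E.
Proof.
move=> mf; rewrite (@integral_dirac _ (borel_rV R 0) (0 : 'rV[R]_0) R setT measurableT f mf).
by rewrite diracT mul1e.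
Qed.

(** A linear form in independent normal variables is normal; induction on the
    dimension, each step being [normal_two_stable]. *)
Lemma integral_iid_normal_dotp (R : realType) (s : R) n (g : 'rV[R]_n) (f : R -> \bar R) :
  s != 0 -> measurable_fun setT f -> (forall x, 0 <= f x)%E ->
  (\int[iid_normal s n]_y f (dotp g y) =
   \int[normal_prob 0 s]_x f (enorm g * x)%R)%E.
Proof.
move=> s0; elim: n g f => [|n IH] g f mf f0.
  rewrite integral_iid_normal0; last first.
    by apply: (measurableT_comp mf); exact: measurable_dotp.
  rewrite /dotp /enorm !big_ord0 sqrtr0.
  under eq_integral do rewrite mul0r.
  by rewrite ge0_integral_prob_cst.
have mfg : measurable_fun setT (fun y : borel_rV R n.+1 => f (dotp g y)).
  by apply: (measurableT_comp mf); exact: measurable_dotp.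
pose g' : 'rV[R]_n := \row_i g 0 (lift ord0 i).
rewrite (@integral_iid_normalS _ s n _ mfg (fun=> f0 _)).
have -> : enorm g = Num.sqrt (g 0 ord0 ^+ 2 + enorm g' ^+ 2).
  rewrite /enorm sqr_sqrtr ?sumr_ge0 // => [|i _]; last exact: sqr_ge0.
  rewrite big_ord_recl; congr (Num.sqrt (_ + _)).
  by apply: eq_bigr => i _; rewrite mxE.
rewrite -(normal_two_stable _ _ s0 mf f0).
apply: eq_integral => x _.
have mfx : measurable_fun setT (fun y : R => f (g 0 ord0 * x + y)).
  by apply: (measurableT_comp mf); exact: measurable_funD.
rewrite -(IH g' _ mfx (fun=> f0 _)).
apply: eq_integral => y _; congr f.
rewrite /dotp big_ord_recl cons_rV_coord0; congr (_ + _).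
by apply: eq_bigr => i _; rewrite cons_rV_coordS mxE.
Qed.

Lemma integral_iid_normal_opp (R : realType) (s : R) n (f : borel_rV R n -> \bar R) :
  s != 0 -> measurable_fun setT f -> (forall x, 0 <= f x)%E ->
  (\int[iid_normal s n]_y f (- (y : 'rV[R]_n))%R = \int[iid_normal s n]_y f y)%E.
Proof.
move=> s0; elim: n f => [|n IH] f mf f0.
  have E (x : 'rV[R]_0) : x = 0 by apply/rowP => -[].
  by apply: eq_integral => y _; congr f; rewrite [RHS]E [LHS]E.
have mfo := measurableT_comp mf (@measurable_opp_rV R n.+1).
rewrite (@integral_iid_normalS _ s n _ mfo (fun=> f0 _)).
rewrite (@integral_iid_normalS _ s n _ mf f0).
have mfc : measurable_fun setT (f \o @cons_rV R n).
  by apply: measurableT_comp => //; exact: measurable_cons_rV.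
pose h (x : R) := (\int[iid_normal s n]_y f (cons_rV (x, y)))%E.
have mh : measurable_fun setT h.
  exact: (measurable_fun_fubini_tonelli_F (f \o @cons_rV R n) mfc (fun=> f0 _)).
have h0 x : (0 <= h x)%E by apply: integral_ge0 => y _; exact: f0.
transitivity (\int[normal_prob 0 s]_x h (- 1 * x)%R)%E; last first.
  rewrite (integral_normal_abs _ s0 mh h0) normrN1.
  by apply: eq_integral => x _; rewrite mul1r.
apply: eq_integral => x _; rewrite mulN1r /h.
have mfx : measurable_fun setT (fun y => f (cons_rV (- x, y))).
  exact: (measurable_fun_pair2 (- x) mfc).
rewrite -(IH _ mfx (fun=> f0 _)).
apply: eq_integral => y _; congr f; apply/rowP => i; rewrite mxE.
by case: (unliftP ord0 i) => [j|] ->; rewrite ?cons_rV_coord0 ?cons_rV_coordS // mxE.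
Qed.

(** * Expected decrease along a Gaussian direction *)

(** Lower bound on the decrease achieved by a step [de *: v] followed by the choice of
    the better point: [max 0] accounts for the option of not moving. *)
Definition gain (R : realType) n (de c : R) (g v : 'rV[R]_n) : R :=
  Num.max 0 (- (de * dotp g v) - c * \sum_(i < n) v 0 i ^+ 2).

Lemma gain_ge0 (R : realType) n (de c : R) (g v : 'rV[R]_n) : 0 <= gain de c g v.
Proof. by rewrite le_max lexx. Qed.

(** For [c >= 0] at most one of the two gains is positive, so the quadratic term is
    charged once for the pair of opposite directions. *)
Lemma gain_add_opp (R : realType) n (de c : R) (g v : 'rV[R]_n) :
  0 <= de ->
  de * `|dotp g v| <=
  gain de c g v + gain de c g (- v) + c * \sum_(i < n) v 0 i ^+ 2.
Proof.
move=> de0; rewrite /gain.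
have -> : dotp g (- v) = - dotp g v.
  by rewrite /dotp -sumrN; apply: eq_bigr => i _; rewrite mxE mulrN.
have -> : \sum_(i < n) (- v) 0 i ^+ 2 = \sum_(i < n) v 0 i ^+ 2.
  by apply: eq_bigr => i _; rewrite mxE sqrrN.
set Q := \sum_(i < n) _; set x := dotp g v.
have h1 (y : R) : 0 <= Num.max 0 y by rewrite le_max lexx.
have h2 (y : R) : y <= Num.max 0 y by rewrite le_max lexx orbT.
have := h1 (- (de * x) - c * Q); have := h1 (- (de * - x) - c * Q).
have := h2 (- (de * x) - c * Q); have := h2 (- (de * - x) - c * Q).
by case: (leP 0 x) => hx; rewrite ?(ger0_norm hx) ?(ltr0_norm hx); lra.
Qed.

Lemma measurable_sqnorm (R : realType) n :
  measurable_fun setT (fun v : borel_rV R n => \sum_(i < n) (v : 'rV[R]_n) 0 i ^+ 2).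
Proof.
by apply: measurable_sum => i; apply: measurable_funX; exact: measurable_coord.
Qed.

Lemma measurable_gain (R : realType) n (de c : R) :
  measurable_fun setT
    (fun gv : borel_rV R n * borel_rV R n => gain de c gv.1 gv.2).
Proof.
apply: measurable_maxr => //; apply: measurable_funB.
  apply: measurableT_comp => //; apply: measurable_funM => //.
  apply: measurable_sum => i; apply: measurable_funM.
    exact: (measurableT_comp (measurable_coord i)).
  exact: (measurableT_comp (measurable_coord i)).
apply: measurable_funM => //.
exact: (measurableT_comp (@measurable_sqnorm R n)).
Qed.

Lemma integral_iid_normal_sqnorm_le (R : realType) (s : R) n : 0 < s ->
  (\int[iid_normal s n]_v (\sum_(i < n) (v : 'rV[R]_n) 0 i ^+ 2)%:E <=
   (n%:R * s ^+ 2)%:E)%E.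
Proof.
move=> s0; have sN0 : s != 0 by rewrite gt_eqF.
under eq_integral do rewrite -sumEFin.
rewrite ge0_integral_sum //; last 2 first.
- by move=> i; apply/measurable_EFinP; apply: measurable_funX; exact: measurable_coord.
- by move=> i x _; rewrite lee_fin sqr_ge0.
rewrite mulr_natl -[X in s ^+ 2 *+ X](card_ord n) -sumr_const -sumEFin.
apply: lee_sum => i _.
have msqr : measurable_fun setT (fun x : R => (x ^+ 2)%:E).
  by apply/measurable_EFinP; apply: continuous_measurable_fun; exact: sqr_continuous.
(* The [i]-th coordinate is the linear form given by a unit vector. *)
have sq0 (x : R) : (0 <= (x ^+ 2)%:E)%E by rewrite lee_fin sqr_ge0.
have := integral_iid_normal_dotp (delta_mx 0 i) sN0 msqr sq0.
have -> : enorm (delta_mx 0 i : 'rV[R]_n) = 1.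
  rewrite /enorm (bigD1 i) //= big1 => [|j ji]; last by rewrite mxE (negbTE ji) andbF expr0n.
  by rewrite mxE !eqxx addr0 expr1n sqrtr1.
under [in RHS]eq_integral do rewrite mul1r.
have := integral_normal_sqr_le s0 => /[swap] <-; apply: le_trans.
rewrite le_eqVlt; apply/orP; left; apply/eqP; apply: eq_integral => v _.
rewrite /dotp (bigD1 i) //= big1 ?addr0 => [|j ji]; last by rewrite mxE (negbTE ji) andbF mul0r.
by rewrite mxE !eqxx mul1r.
Qed.

(** Integrating [gain_add_opp] and using the symmetry of the Gaussian law, twice the
    expected gain is at least [de * E|<g, v>| - c * E|v|^2]. *)
Lemma integral_gain_ge (R : realType) (s de c : R) n (g : 'rV[R]_n) :
  0 < s -> 0 <= de -> 0 <= c ->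
  ((de * enorm g * s / Num.sqrt (2 * pi))%:E <=
   \int[iid_normal s n]_v (gain de c g v)%:E + (c * (n%:R * s ^+ 2) / 2)%:E)%E.
Proof.
move=> s0 de0 c0; have sN0 : s != 0 by rewrite gt_eqF.
set I := (\int[_]_v _)%E.
have mg : measurable_fun setT (fun v : borel_rV R n => (gain de c g v)%:E).
  by apply/measurable_EFinP; exact: (measurable_fun_pair2 (g : borel_rV R n) (@measurable_gain R n de c)).
have g0 v : (0 <= (gain de c g v)%:E)%E by rewrite lee_fin gain_ge0.
have mgo := measurableT_comp mg (@measurable_opp_rV R n).
have msq : measurable_fun setT
    (fun v : borel_rV R n => (c * \sum_(i < n) (v : 'rV[R]_n) 0 i ^+ 2)%:E).
  by apply/measurable_EFinP; apply: measurable_funM => //; exact: measurable_sqnorm.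
have sq0 (v : 'rV[R]_n) : (0 <= \sum_(i < n) v 0 i ^+ 2).
  by apply: sumr_ge0 => i _; exact: sqr_ge0.
have csq0 (v : 'rV[R]_n) : (0 <= (c * \sum_(i < n) v 0 i ^+ 2)%:E)%E.
  by rewrite lee_fin mulr_ge0.
have Iopp : (\int[iid_normal s n]_v (gain de c g (- (v : 'rV[R]_n)))%:E = I)%E.
  exact: (integral_iid_normal_opp sN0 mg g0).
have mabs : measurable_fun setT (fun x : R => (`|x|)%:E).
  by apply/measurable_EFinP; exact: normr_measurable.
have lhs : (\int[iid_normal s n]_v (de * `|dotp g v|)%:E =
    (de * (enorm g * (2 * s / Num.sqrt (2 * pi))))%:E)%E.
  under eq_integral do rewrite EFinM.
  rewrite ge0_integralZl //; last first.
    by apply: (measurableT_comp mabs); exact: measurable_dotp.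
  rewrite (@integral_iid_normal_dotp _ s n g (fun x => `|x|%:E) sN0 mabs); last first.
    by move=> x; rewrite lee_fin.
  under eq_integral do rewrite normrM EFinM.
  rewrite ge0_integralZl // [X in (_ * (_ * X))%E](integral_normal_norm s0).
  by rewrite -!EFinM ger0_norm ?sqrtr_ge0.
have key : ((de * (enorm g * (2 * s / Num.sqrt (2 * pi))))%:E <=
    I + I + (c * (n%:R * s ^+ 2))%:E)%E.
  rewrite -lhs.
  apply: (@le_trans _ _ (\int[iid_normal s n]_v ((gain de c g v)%:E +
      (gain de c g (- (v : 'rV[R]_n)))%:E + (c * \sum_(i < n) (v : 'rV[R]_n) 0 i ^+ 2)%:E))%E).
    apply: ge0_le_integral => //.
    - by move=> v _; rewrite lee_fin mulr_ge0.
    - apply/measurable_EFinP; apply: measurable_funM => //.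
      by apply: measurableT_comp => //; exact: measurable_dotp.
    - by apply: emeasurable_funD => //; apply: emeasurable_funD.
    - by move=> v _; rewrite -!EFinD lee_fin gain_add_opp.
  rewrite ge0_integralD //; last 2 first.
  - by move=> v _; rewrite adde_ge0 // lee_fin gain_ge0.
  - exact: emeasurable_funD.
  rewrite ge0_integralD //.
  rewrite Iopp leeD2l //.
  under eq_integral do rewrite EFinM.
  rewrite ge0_integralZl //; first last.
  - by move=> v _; rewrite lee_fin.
  - by apply/measurable_EFinP; exact: measurable_sqnorm.
  by rewrite EFinM lee_wpmul2l ?lee_fin // integral_iid_normal_sqnorm_le.
have : (0 <= I)%E by apply: integral_ge0.
move: key; clear Iopp; case: I => [r| |] //; last by move=> _ _; rewrite addye // leey.
rewrite -!EFinD !lee_fin => key _.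
set b := (Num.sqrt _)^-1 in key *.
lra.
Qed.

(** * Independence of the current state and the next innovation *)

(** The right-hand side and the left-hand side, as functions of [C], are measures that
    agree on rectangles.  The event [F] stands for conditions on later innovations,
    of total probability [c]. *)
Lemma joint_law_on_event (R : realType) d d1 d2 (Omega : measurableType d)
    (T1 : measurableType d1) (T2 : measurableType d2) (P : probability Omega R)
    (X : {mfun Omega >-> T1}) (Y : {mfun Omega >-> T2})
    (F : set Omega) (c : {nonneg R}) :
  measurable F ->
  (forall A B, measurable A -> measurable B ->
     P (X @^-1` A `&` (Y @^-1` B `&` F)) =
       (P (X @^-1` A) * (P (Y @^-1` B) * c%:num%:E))%E) ->
  forall C, measurable C ->
    P ((fun w => (X w, Y w)) @^-1` C `&` F) =
    (c%:num%:E * (distribution P X \x distribution P Y) C)%E.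
Proof.
move=> mF indep C mC.
have mXY : measurable_fun setT (fun w => (X w, Y w)).
  exact: measurable_fun_pair.
pose m1 : {finite_measure set T1 -> \bar R} := mscale c (distribution P X).
pose m2 : {finite_measure set T2 -> \bar R} := distribution P Y.
pose m'_ : {measure set (T1 * T2) -> \bar R} :=
  pushforward (mrestr P mF) (fun w => (X w, Y w)).
pose m' := m'_ mXY.
pose m'' : {measure set (T1 * T2) -> \bar R} :=
  mscale c (distribution P X \x distribution P Y)%E.
have E' : (m1 \x m2)%E C = m' C.
  apply: product_measure_unique => // A B mA mB.
  rewrite [LHS](_ : _ = P (X @^-1` A `&` (Y @^-1` B `&` F))); last first.
    by rewrite /m' /m'_ /= /pushforward /mrestr setIA.
  by rewrite indep // muleA muleC muleA.
have E'' : (m1 \x m2)%E C = m'' C.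
  apply: product_measure_unique => // A B mA mB.
  rewrite /m'' /= /mscale /= product_measure1E //.
  by rewrite muleA.
exact: etrans (esym E') E''.
Qed.

Section recursive_process.
Context (R : realType) d d1 d2 (Omega : measurableType d)
  (T1 : measurableType d1) (T2 : measurableType d2) (P : probability Omega R).
Variables (X : nat -> Omega -> T1) (v : nat -> {RV P >-> T2})
  (G : nat -> T1 * T2 -> T1) (x0 : T1).
Hypothesis mG : forall t, measurable_fun setT (G t).
Hypothesis X0 : forall w, X 0%N w = x0.
Hypothesis XS : forall t w, ~~ odd t -> X t.+2 w = G t (X t w, v t w).
Hypothesis hindep : mutually_independent [pred t | ~~ odd t] v.

Lemma measurable_process k : measurable_fun setT (X k.*2).
Proof.
elim: k => [|k IH].
  by rewrite (_ : X 0.*2 = cst x0); [exact: measurable_cst|apply/funext].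
rewrite doubleS (_ : X _ = G k.*2 \o (fun w => (X k.*2 w, v k.*2 w))).
  by apply: measurableT_comp => //; exact: measurable_fun_pair.
by apply/funext => w; rewrite XS // odd_double.
Qed.

HB.instance Definition _ k :=
  isMeasurableFun.Build _ _ _ _ (X k.*2) (measurable_process k).

Let ev (s : seq nat) (A : nat -> set T2) : set Omega :=
  [set w | forall t, t \in s -> A t (v t w)].

Let ev_cons t s A : ev (t :: s) A = (v t @^-1` A t) `&` ev s A.
Proof.
apply/seteqP; split=> w /=.
  by move=> H; split=> [|r rs]; apply: H; rewrite inE ?eqxx ?rs ?orbT.
by move=> [At H] r /[!inE] /orP[/eqP->//|]; exact: H.
Qed.

Let measurable_ev s A : (forall t, measurable (A t)) -> measurable (ev s A).
Proof.
move=> mA; elim: s => [|t s IH].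
  by rewrite (_ : ev [::] A = setT) //; apply/seteqP.
rewrite ev_cons; apply: measurableI => //.
exact: measurable_funPTI.
Qed.

(** The future events are part of the induction statement: to pass from [X k.*2] to
    [X k.*2.+2 = G (X k.*2, v k.*2)], the joint law of [X k.*2] and [v k.*2] is
    needed on the event that fixes the still later innovations, and the induction
    hypothesis gives it on rectangles by adding [k.*2] to the list of future times. *)
Lemma process_independent_future k (s : seq nat) (A : nat -> set T2) (B : set T1) :
  uniq s -> all (fun t => ~~ odd t && (k.*2 <= t)%N) s ->
  (forall t, measurable (A t)) -> measurable B ->
  P (X k.*2 @^-1` B `&` ev s A) =
  (P (X k.*2 @^-1` B) * \prod_(t <- s) P (v t @^-1` A t))%E.
Proof.
elim: k s A B => [|k IH] s A B us als mA mB.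
  have als' : all [pred t | ~~ odd t] s by apply: sub_all als => t /andP[].
  have E : X 0.*2 @^-1` B = if x0 \in B then setT else set0.
    case: ifPn => xB; apply/seteqP; split=> w //=; rewrite X0.
    - by move=> _; exact: set_mem.
    - by move=> Bx; move/negP: xB; apply; exact: mem_set.
  rewrite E; case: ifP => _.
    by rewrite setTI probability_setT mul1e; exact: hindep.
  by rewrite set0I measure0 mul0e.
pose mfX : {mfun Omega >-> T1} := X k.*2.
have als1 : all (fun t => ~~ odd t && (k.*2 <= t)%N) s.
  apply: sub_all als => t /andP[-> /=]; rewrite doubleS => /ltnW /ltnW //.
have als2 : all (fun t => ~~ odd t && (k.*2 <= t)%N) (k.*2 :: s).
  by rewrite /= odd_double leqnn als1.
have us2 : uniq (k.*2 :: s).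
  rewrite /= us andbT; apply/negP => /(allP als) /andP[_].
  by rewrite doubleS ltnNge leqnSn.
have pfin t C : measurable C -> P (v t @^-1` C) \is a fin_num.
  by move=> mC; apply: fin_num_measure; exact: measurable_funPTI.
set c := (\prod_(t <- s) _)%E.
have cfin : c \is a fin_num by rewrite /c; apply: prode_fin_num => t _; exact: pfin.
have c0 : (0 <= c)%E by apply: prode_ge0.
have cn : (0 <= fine c)%R by exact: fine_ge0.
have key (F : set Omega) (cF : {nonneg R}) (mF : measurable F) :
  (forall A B, measurable A -> measurable B ->
     P (mfX @^-1` A `&` (v k.*2 @^-1` B `&` F)) =
       (P (mfX @^-1` A) * (P (v k.*2 @^-1` B) * cF%:num%:E))%E) ->
  P (X k.+1.*2 @^-1` B `&` F) =
   (cF%:num%:E * (distribution P mfX \x distribution P (v k.*2)) (G k.*2 @^-1` B))%E.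
  move=> H; rewrite -(joint_law_on_event mF H); last first.
    by rewrite -[X in measurable X]setTI; exact: mG.
  congr (P (_ `&` _)); apply/seteqP; split=> w /=; by rewrite doubleS XS ?odd_double.
have IHA C B' : measurable C -> measurable B' ->
     P (mfX @^-1` C `&` (v k.*2 @^-1` B' `&` ev s A)) =
       (P (mfX @^-1` C) * (P (v k.*2 @^-1` B') * c))%E.
  move=> mC mB'.
  pose A' t := if t == k.*2 then B' else A t.
  have mA' t : measurable (A' t) by rewrite /A'; case: ifP.
  have := IH _ _ C us2 als2 mA' mC.
  rewrite ev_cons big_cons /A' eqxx.
  have sE t : t \in s -> (t == k.*2) = false.
    by move=> ts; apply/negP => /eqP E; move: us2; rewrite /= -E ts.
  have -> : ev s A' = ev s A.
    by apply/seteqP; split=> w /= H t ts; move: (H t ts); rewrite /A' sE.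
  by rewrite (eq_big_seq (fun t => P (v t @^-1` A t))) // => t ts; rewrite sE.
(* The same with an empty future, which identifies the law of the next state. *)
have IHT C B' : measurable C -> measurable B' ->
     P (mfX @^-1` C `&` (v k.*2 @^-1` B' `&` setT)) =
       (P (mfX @^-1` C) * (P (v k.*2 @^-1` B') * (1%:nng%:num : R)%:E))%E.
  move=> mC mB'.
  have := IH [:: k.*2] _ C isT _ (fun=> mB') mC.
  rewrite /= odd_double leqnn big_cons big_nil => /(_ isT) <-.
  congr (P (_ `&` _)); rewrite ev_cons; congr (_ `&` _).
  by apply/seteqP.
rewrite (key _ (NngNum cn) (measurable_ev s mA)) /=; last first.
  by move=> C B' mC mB'; rewrite fineK //; exact: IHA.
have := key setT 1%:nng measurableT IHT; rewrite setIT => -> /=.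
by rewrite mul1e fineK // muleC.
Qed.

Lemma process_joint_law k C : measurable C ->
  P ((fun w => (X k.*2 w, v k.*2 w)) @^-1` C) =
  ((distribution P (X k.*2) \x distribution P (v k.*2)) C)%E.
Proof.
move=> mC; have := @joint_law_on_event R _ _ _ _ _ _ P (X k.*2) (v k.*2) setT 1%:nng measurableT _ C mC.
rewrite setIT /= mul1e; apply => A B mA mB.
have := @process_independent_future k [:: k.*2] (fun=> B) A isT _ (fun=> mB) mA.
rewrite /= odd_double leqnn big_cons big_nil => /(_ isT) <-.
congr (P (_ `&` _)); rewrite ev_cons; congr (_ `&` _).
by apply/seteqP.
Qed.

(** Freezing the state: conditionally on [X k.*2], the innovation [v k.*2] keeps its
    law. *)
Lemma process_joint_integral k (f : T1 * T2 -> \bar R) :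
  measurable_fun setT f -> (forall xy, 0 <= f xy)%E ->
  (\int[P]_w f (X k.*2 w, v k.*2 w) =
   \int[P]_w \int[distribution P (v k.*2)]_y f (X k.*2 w, y))%E.
Proof.
move=> mf f0.
have mXY : measurable_fun setT (fun w => (X k.*2 w, v k.*2 w)).
  exact: measurable_fun_pair.
pose nu_ : {measure set (T1 * T2) -> \bar R} :=
  pushforward P (fun w => (X k.*2 w, v k.*2 w)).
transitivity (\int[nu_ mXY]_xy f xy)%E.
  by rewrite ge0_integral_pushforward // preimage_setT.
rewrite (eq_measure_integral (distribution P (X k.*2) \x distribution P (v k.*2))%E); last first.
  by move=> C mC _; exact: process_joint_law.
rewrite (fubini_tonelli1 f mf f0).
rewrite ge0_integral_distribution //.
  exact: (measurable_fun_fubini_tonelli_F f mf f0).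
by move=> x; apply: integral_ge0 => y _.
Qed.

End recursive_process.

(** * Two-point direct search *)

Lemma gap_le_sup (R : realType) n (f g : 'rV[R]_n -> R) (u : 'rV[R]_n) :
  has_ubound (gaps f g) -> `|f u - g u| <= sup (gaps f g).
Proof. by move=> ub; apply: ub_le_sup => //; exists u. Qed.

Lemma sup_gaps_ge0 (R : realType) n (f g : 'rV[R]_n -> R) :
  has_ubound (gaps f g) -> 0 <= sup (gaps f g).
Proof. by move=> ub; apply: le_trans (gap_le_sup 0 ub). Qed.

(** A rejected step pays [drift Phi t] twice when it is compared with the trial point:
    once there, because the oracle saw [Phi t.+1] and not [Phi t], and once at the
    point that is kept, where [Phi t] turns into [Phi t.+1]. *)
Definition step_error (R : realType) n (Phi Phit : nat -> 'rV[R]_n -> R) (t : nat) : R :=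
  2 * drift Phi t + drift Phi t.+1 +
  oracle_error Phi Phit t + oracle_error Phi Phit t.+1.

Lemma sum_step_error_le (R : realType) n (Phi Phit : nat -> 'rV[R]_n -> R) m :
  (forall t, has_ubound (gaps (Phi t.+1) (Phi t))) ->
  (forall t, has_ubound (gaps (Phit t) (Phi t))) ->
  \sum_(j < m) step_error Phi Phit j.*2 <=
  2 * total_drift Phi m.*2 + 2 * total_oracle_error Phi Phit m.*2.
Proof.
move=> hd hb; elim: m => [|m IH].
  by rewrite big_ord0 /total_drift /total_oracle_error !big_geq // mulr0 addr0.
rewrite big_ord_recr /= doubleS.
move: IH; rewrite /total_drift /total_oracle_error !big_nat_recr //= /step_error.
have d0 t : 0 <= drift Phi t by exact: sup_gaps_ge0.
have b0 t : 0 <= oracle_error Phi Phit t by exact: sup_gaps_ge0.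
have := d0 m.*2.+1; have := b0 m.*2; have := b0 m.*2.+1.
lra.
Qed.

Definition search_step (R : realType) n (Phit : nat -> 'rV[R]_n -> R) (de : R)
    (t : nat) (xy : borel_rV R n * borel_rV R n) : borel_rV R n :=
  let y : 'rV[R]_n := (xy.1 : 'rV[R]_n) + de *: (xy.2 : 'rV[R]_n) in
  if Phit t.+1 y <= Phit t xy.1 then y else xy.1.

Lemma measurable_search_step (R : realType) n (Phit : nat -> 'rV[R]_n -> R) (de : R) t :
  (forall t, continuous (Phit t)) ->
  measurable_fun setT (search_step Phit de t).
Proof.
move=> cont.
have my : measurable_fun setT (fun xy : borel_rV R n * borel_rV R n =>
    ((xy.1 : 'rV[R]_n) + de *: (xy.2 : 'rV[R]_n) : borel_rV R n)).
  apply: measurable_fun_rV => i.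
  under [X in measurable_fun _ X]eq_fun do rewrite !mxE.
  apply: measurable_funD.
    exact: (measurableT_comp (measurable_coord i)).
  apply: measurable_funM => //.
  exact: (measurableT_comp (measurable_coord i)).
apply: measurable_fun_ifT => //.
apply: measurable_fun_ler.
  exact: (measurableT_comp (continuous_borel_measurable (cont t.+1)) my).
exact: (measurableT_comp (continuous_borel_measurable (cont t)) measurable_fst).
Qed.

(** The claim is the conjunction of two bounds, against [Phi t x] and against [Phi t] at
    the trial point, that correspond to the two arguments of the maximum in [gain];
    [smooth_descent] turns the second into the stated form. *)
Lemma search_step_decrease (R : realType) n (L de : R)
    (Phi Phit : nat -> 'rV[R]_n -> R) t (x y : 'rV[R]_n) :
  0 < L -> smooth L (Phi t) ->
  (forall t, has_ubound (gaps (Phi t.+1) (Phi t))) ->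
  (forall t, has_ubound (gaps (Phit t) (Phi t))) ->
  Phi t.+2 (search_step Phit de t (x, y)) +
    gain de (L * de ^+ 2 / 2) (gradient (Phi t) x) y <=
  Phi t x + step_error Phi Phit t.
Proof.
move=> L0 sm hd hb; rewrite /step_error.
have D s z : `|Phi s.+1 z - Phi s z| <= drift Phi s by exact: gap_le_sup.
have B s z : `|Phit s z - Phi s z| <= oracle_error Phi Phit s by exact: gap_le_sup.
have d0 s : 0 <= drift Phi s by exact: sup_gaps_ge0.
have b0 s : 0 <= oracle_error Phi Phit s by exact: sup_gaps_ge0.
have := smooth_descent x (de *: y) L0 sm.
have -> : L / 2 * enorm (de *: y) ^+ 2 = L * de ^+ 2 / 2 * \sum_(i < n) y 0 i ^+ 2.
  by rewrite enormZ exprMn enorm_sqr real_normK ?num_real //; ring.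
rewrite dotpZr.
rewrite /gain; set a := de * _; set q := _ * \sum_(i < n) _.
rewrite /search_step /=; set z := x + de *: y => desc.
have := (d0 t, d0 t.+1, b0 t, b0 t.+1) => -[[[h1 h2] h3] h4].
case: ifPn => [acc|]; last rewrite -ltNge => rej.
  have := D t.+1 z; have := D t z; have := B t x; have := B t.+1 z.
  rewrite !ler_norml => /andP[? ?] /andP[? ?] /andP[? ?] /andP[? ?].
  by rewrite /Num.max; case: ifP => _; lra.
have := D t.+1 x; have := D t x; have := D t z; have := B t x; have := B t.+1 z.
rewrite !ler_norml => /andP[? ?] /andP[? ?] /andP[? ?] /andP[? ?] /andP[? ?].
by rewrite /Num.max; case: ifP => _; lra.
Qed.

Section search.
Context (R : realType) (p : nat) (L : R) (Phi : nat -> 'rV[R]_p -> R) (Phi_low : R)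
  (Phit : nat -> 'rV[R]_p -> R)
  (d : measure_display) (Omega : measurableType d) (P : probability Omega R)
  (v : nat -> {RV P >-> borel_rV R p}) (u0 : 'rV[R]_p) (de : R)
  (u : nat -> Omega -> 'rV[R]_p).
Hypotheses (hp : (1 <= p)%N) (hL : 0 < L) (de0 : 0 < de)
  (hsmooth : forall t, smooth L (Phi t))
  (hlow : forall t u, Phi_low <= Phi t u)
  (hcont : forall t, continuous (Phit t))
  (hdrift : forall t, has_ubound (gaps (Phi t.+1) (Phi t)))
  (horacle : forall t, has_ubound (gaps (Phit t) (Phi t)))
  (hgauss : forall t, ~~ odd t -> gaussian_vector 0 (p%:R^-1)%:M (v t))
  (hindep : mutually_independent [pred t | ~~ odd t] v)
  (hu : two_point_direct_search Phit u0 (fun=> de) v u).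

Let c := L * de ^+ 2 / 2.
Let grad t w := gradient (Phi t) (u t w).
Let E j := (\int[P]_w (enorm (grad j.*2 w))%:E)%E.
Let H j := (\int[P]_w (gain de c (grad j.*2 w) (v j.*2 w))%:E)%E.

Let u0E w : u 0%N w = u0. Proof. by have [h _] := hu. Qed.

Let uSS t w : ~~ odd t -> u t.+2 w = search_step Phit de t (u t w, v t w).
Proof. by have [_ h] := hu => /(h t w)[E1 ->]; rewrite E1. Qed.

Let mstep t : measurable_fun setT (search_step Phit de t).
Proof. exact: measurable_search_step. Qed.

Let miter k : measurable_fun setT (u k.*2 : Omega -> borel_rV R p).
Proof. exact: (@measurable_process R d _ _ Omega (borel_rV R p) (borel_rV R p) P u v _ u0 mstep u0E uSS). Qed.

Let mgrad k : measurable_fun setT (grad k.*2 : Omega -> borel_rV R p).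
Proof. exact: (measurableT_comp (measurable_gradient (hsmooth k.*2)) (miter k)). Qed.

Lemma sum_gain_le m w :
  \sum_(j < m) gain de c (grad j.*2 w) (v j.*2 w) <=
  Phi 0%N u0 - Phi_low + \sum_(j < m) step_error Phi Phit j.*2.
Proof.
suff : Phi m.*2 (u m.*2 w) + \sum_(j < m) gain de c (grad j.*2 w) (v j.*2 w) <=
    Phi 0%N u0 + \sum_(j < m) step_error Phi Phit j.*2.
  by have := hlow m.*2 (u m.*2 w); lra.
elim: m => [|m IH]; first by rewrite !big_ord0 !addr0 u0E.
rewrite !big_ord_recr /= doubleS uSS ?odd_double //.
have := @search_step_decrease R p L de Phi Phit m.*2 (u m.*2 w) (v m.*2 w) hL
  (hsmooth _) hdrift horacle.
rewrite -/c -/(grad _ _); move: IH; lra.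
Qed.

Let mH j : measurable_fun setT (fun w => (gain de c (grad j.*2 w) (v j.*2 w))%:E).
Proof.
apply/measurable_EFinP.
have mv : measurable_fun setT (v j.*2) by exact: measurable_funPT.
exact: (measurableT_comp (@measurable_gain R p de c)
  (measurable_fun_pair (mgrad j) mv)).
Qed.

Lemma sum_expected_gain_le m :
  (\sum_(j < m) H j <=
   (Phi 0%N u0 - Phi_low + \sum_(j < m) step_error Phi Phit j.*2)%:E)%E.
Proof.
rewrite -ge0_integral_sum //; last by move=> j w _; rewrite lee_fin gain_ge0.
set K := (X in (_ <= X)%E).
rewrite -[leRHS](ge0_integral_prob_cst P K).
apply: ge0_le_integral => //.
- by move=> w _; apply: sume_ge0 => j _; rewrite lee_fin gain_ge0.
- exact: emeasurable_sum.
- by move=> w _; rewrite sumEFin lee_fin sum_gain_le.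
Qed.

Lemma expected_gain_ge j :
  ((de / Num.sqrt (2 * pi * p%:R))%:E * E j <= H j + (c / 2)%:E)%E.
Proof.
have p0 : 0 < p%:R :> R by rewrite ltr0n.
pose s : R := (Num.sqrt p%:R)^-1.
have s0 : 0 < s by rewrite invr_gt0 sqrtr_gt0.
have s2 : s ^+ 2 = p%:R^-1 by rewrite exprVn sqr_sqrtr // ltW.
have odj : ~~ odd j.*2 by rewrite odd_double.
pose f (xy : borel_rV R p * borel_rV R p) :=
  (gain de c (gradient (Phi j.*2) xy.1) xy.2)%:E.
have mf : measurable_fun setT f.
  apply/measurable_EFinP.
  exact: (measurableT_comp (@measurable_gain R p de c) (measurable_fun_pair
    (measurableT_comp (measurable_gradient (hsmooth j.*2)) measurable_fst)
    measurable_snd)).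
have f0 xy : (0 <= f xy)%E by rewrite lee_fin gain_ge0.
have HE : H j = (\int[P]_w \int[iid_normal s p]_y f (u j.*2 w, y))%E.
  rewrite /H (@process_joint_integral R d _ _ Omega (borel_rV R p) (borel_rV R p)
    P u v _ u0 mstep u0E uSS hindep j f mf f0).
  apply: eq_integral => w _; apply: eq_measure_integral => A mA _.
  apply: gaussian_vector_distribution => //.
  by rewrite s2; exact: hgauss.
rewrite HE.
have mI : measurable_fun setT (fun w => \int[iid_normal s p]_y f (u j.*2 w, y))%E.
  exact: (measurableT_comp (measurable_fun_fubini_tonelli_F f mf f0) (miter j)).
have I0 w : (0 <= \int[iid_normal s p]_y f (u j.*2 w, y))%E.
  by apply: integral_ge0 => y _.
have c0 : 0 <= c by rewrite /c divr_ge0 // mulr_ge0 ?sqr_ge0 // ltW.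
have mE : measurable_fun setT (fun w => (enorm (grad j.*2 w))%:E).
  apply/measurable_EFinP; exact: (measurableT_comp (@measurable_enorm R p) (mgrad j)).
rewrite /E -ge0_integralZl //; last 2 first.
- by move=> w _; rewrite lee_fin sqrtr_ge0.
- by rewrite lee_fin divr_ge0 ?sqrtr_ge0 // ltW.
rewrite -(ge0_integral_prob_cst P (c / 2)%:E) -ge0_integralD //; last first.
  by move=> w _; rewrite lee_fin divr_ge0.
apply: ge0_le_integral => //.
- by move=> w _; rewrite -EFinM lee_fin mulr_ge0 ?divr_ge0 ?sqrtr_ge0 // ltW.
- exact: emeasurable_funM.
- exact: emeasurable_funD.
- move=> w _.
  have := integral_gain_ge (grad j.*2 w) s0 (ltW de0) c0.
  rewrite s2 divff ?gt_eqF // mulr1; apply: le_trans.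
  rewrite -EFinM lee_fin le_eqVlt; apply/orP; left; apply/eqP.
  rewrite sqrtrM ?mulr_ge0 ?pi_ge0 // /s; field.
  by rewrite !gt_eqF // sqrtr_gt0 // mulr_gt0 // pi_gt0.
Qed.

End search.

(** With [n] the dimension and [q] standing for [pi]: the probing ratio balances the
    linear gain, [6 * Q] per even time when the gradient has norm [eps], against the quadratic loss [2 * Q], which leaves
    [4 * Q] for the initial gap and the errors. *)
Lemma probing_ratio_constants (R : realFieldType) (eps n q L S : R) :
  0 < n -> 0 < q -> 0 < L -> 0 < S -> S ^+ 2 = 2 * q * n ->
  let de := 4 * eps / (3 * S * L) in
  let Q := eps ^+ 2 / (9 * q * n * L) in
  de / S * eps = 6 * Q /\ L * de ^+ 2 / 2 / 2 = 2 * Q.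
Proof.
move=> n0 q0 L0 S0 S2 de Q.
have QE : Q = 2 / 9 * eps ^+ 2 / (S ^+ 2 * L).
  by rewrite S2 /Q; field; rewrite !gt_eqF.
by rewrite QE /de; split; field; rewrite !gt_eqF.
Qed.

Theorem theorem3p2 (R : realType) (p : nat) (hp : (1 <= p)%N)
    (L : R) (hL : 0 < L)
    (Phi : nat -> 'rV[R]_p -> R)
    (hsmooth : forall t, smooth L (Phi t))
    (Phi_low : R) (hlow : forall t u, Phi_low <= Phi t u)
    (Phit : nat -> 'rV[R]_p -> R)
    (hcont : forall t, continuous (Phit t))
    (hdrift : forall t, has_ubound (gaps (Phi t.+1) (Phi t)))
    (horacle : forall t, has_ubound (gaps (Phit t) (Phi t)))
    (d : measure_display) (Omega : measurableType d) (P : probability Omega R)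
    (v : nat -> {RV P >-> borel_rV R p})
    (hgauss : forall t, ~~ odd t -> gaussian_vector 0 (p%:R^-1)%:M (v t))
    (hindep : mutually_independent [pred t | ~~ odd t] v)
    (u0 : 'rV[R]_p) (eps : R) (heps : 0 < eps)
    (u : nat -> Omega -> 'rV[R]_p)
    (hu : two_point_direct_search Phit u0
            (fun=> 4 * eps / (3 * Num.sqrt (2 * pi * p%:R) * L)) v u)
    (T : nat) (hT2 : (2 <= T)%N) (hTeven : ~~ odd T)
    (hE : (2 * total_drift Phi T + 2 * total_oracle_error Phi Phit T) / T%:R
            <= eps ^+ 2 / (9 * pi * p%:R * L))
    (hT : 9 * pi * p%:R * L * (Phi 0%N u0 - Phi_low) * eps ^- 2 <= T%:R) :
  (\big[Order.min/+oo]_(0 <= t < T | ~~ odd t)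
     'E_P[fun w => enorm (gradient (Phi t) (u t w))] <= eps%:E)%E.
Proof.
move: hu; set S := Num.sqrt _; set de := _ / _ => hu'.
have pi0 : 0 < pi :> R by exact: pi_gt0.
have p0 : 0 < p%:R :> R by rewrite ltr0n.
have S0 : 0 < S by rewrite sqrtr_gt0 !mulr_gt0.
have S2 : S ^+ 2 = 2 * pi * p%:R by rewrite sqr_sqrtr // !mulr_ge0 // ltW.
have de0 : 0 < de by rewrite divr_gt0 // !mulr_gt0.
pose m := T./2.
have Tm : T = m.*2 by rewrite -[LHS]odd_double_half (negbTE hTeven).
have m0 : (0 < m)%N by rewrite half_gt0.
pose E j := (\int[P]_w (enorm (gradient (Phi j.*2) (u j.*2 w)))%:E)%E.
pose H j := (\int[P]_w (gain de (L * de ^+ 2 / 2)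
  (gradient (Phi j.*2) (u j.*2 w)) (v j.*2 w))%:E)%E.
pose K := Phi 0%N u0 - Phi_low + \sum_(j < m) step_error Phi Phit j.*2.
have sumH : (\sum_(j < m) H j <= K%:E)%E.
  exact: (sum_expected_gain_le hL hsmooth hlow hcont hdrift horacle hu').
have HE j : ((de / S)%:E * E j <= H j + (L * de ^+ 2 / 2 / 2)%:E)%E.
  exact: (expected_gain_ge hp hL de0 hsmooth hcont hgauss hindep hu').
have H0 j : (0 <= H j)%E by apply: integral_ge0 => w _; rewrite lee_fin gain_ge0.
have a0 : 0 < de / S by rewrite divr_gt0.
have [j Ej] : exists j : 'I_m, (E j <= eps%:E)%E.
  apply: contrapT => /forallNP noj.
  have big j : (j < m)%N -> (eps%:E < E j)%E.
    by move=> jm; rewrite ltNge; apply/negP; exact: (noj (Ordinal jm)).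
  have Hfin (j : 'I_m) : H j \is a fin_num.
    rewrite ge0_fin_numE //; apply: le_lt_trans (ltry K); apply: le_trans sumH.
    by rewrite (bigD1 j) //= leeDl // sume_ge0.
  have csum x : m%:R * x = \sum_(j < m) x by rewrite sumr_const card_ord mulr_natl.
  have lower : m%:R * (de / S * eps) <
      \sum_(j < m) fine (H j) + m%:R * (L * de ^+ 2 / 2 / 2).
    rewrite !csum -big_split /=.
    apply: ltr_sum => [|j _]; first by apply/hasP; exists (Ordinal m0); rewrite ?mem_index_enum.
    rewrite -lte_fin EFinD fineK // EFinM.
    apply: lt_le_trans (HE j).
    by rewrite lte_pmul2l ?lte_fin // big.
  have upper : \sum_(j < m) fine (H j) <= K.
    by rewrite -lee_fin -sumEFin (eq_bigr (fun j : 'I_m => H j)) // => j _; rewrite fineK.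
  have KE : K <= 4 * (m%:R * (eps ^+ 2 / (9 * pi * p%:R * L))).
    have TE : T%:R = 2 * m%:R :> R by rewrite Tm -mul2n natrM.
    have T0 : 0 < T%:R :> R by rewrite ltr0n (leq_trans _ hT2).
    have := sum_step_error_le m hdrift horacle; rewrite -Tm.
    move: hE; rewrite ler_pdivrMr // TE => hE1.
    have hT1 : Phi 0%N u0 - Phi_low <= 2 * (m%:R * (eps ^+ 2 / (9 * pi * p%:R * L))).
      move: hT; set q := 9 * pi * p%:R * L => hT1.
      have q0 : 0 < q by rewrite !mulr_gt0.
      rewrite (mulrA 2) -TE mulrA ler_pdivlMr // mulrC.
      by rewrite -ler_pdivrMr ?exprn_gt0.
    rewrite /K; lra.
  have [aE cE] := probing_ratio_constants eps p0 pi0 hL S0 S2.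
  move: lower; rewrite aE cE; lra.
apply: (@bigmin_inf_seq _ _ _ _ _ j.*2).
- by rewrite mem_index_iota /= Tm ltn_double ltn_ord.
- by rewrite odd_double.
- by rewrite unlock; exact: Ej.
Qed.
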